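(* Let $X$ be a $G$-Banach space. If $X$ has both the Radon-Nikodým property and the $G$-Daugavet property, then $n_G(X)=1$. In particular, $n_{\mathrm{Iso}(L^p[0,1])}(L^p[0,1])=1$ for every $1<p<\infty$.
   Context: Banach spaces are over $\mathbb K=\mathbb R$ or $\mathbb C$; $S_X$ is the unit sphere, $X^*$ the dual, $\mathcal L(X)$ the space of bounded linear operators on $X$, and $\mathrm{Iso}(X)$ the group of all surjective linear isometries of $X$, acting naturally. A $G$-Banach space is a Banach space $X$ endowed with an action of a group $G$ by surjective linear isometries (no continuity assumed). $X$ has the $G$-Daugavet property if every rank-one bounded linear operator $T:X\to X$ satisfies $\sup_{g\in G}\|\mathrm{Id}_X+g\circ T\|=1+\|T\|$, where $(g\circ T)(x)=g(Tx)$. For $T\in\mathcal L(X)$, $v_G(T)=\sup\{\mathrm{Re}\,x^*(T(gx)):x\in S_X,\ x^*\in S_{X^*},\ x^*(x)=1,\ g\in G\}$, and the $G$-numerical index of $X$ is $n_G(X)=\inf\{v_G(T):T\in\mathcal L(X),\ \|T\|=1\}$. *)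

(* Defs.v *)
From HB Require Import structures.
From mathcomp Require Import all_boot all_order all_algebra.
From mathcomp Require Import ring_quotient.
From mathcomp Require Import complex.
From mathcomp Require Import all_classical all_reals all_analysis.
From mathcomp Require Import measurable_realfun.

Set Implicit Arguments.
Unset Strict Implicit.
Unset Printing Implicit Defensive.

Import Order.TTheory GRing.Theory Num.Theory.
Import numFieldNormedType.Exports.

Local Open Scope classical_set_scope.
Local Open Scope ring_scope.

Inductive scalar_kind := RealScalars | ComplexScalars.

Definition scalar_field (R : realType) (k : scalar_kind) : numFieldType :=
  match k with
  | RealScalars => R
  | ComplexScalars => R[i]
  end.

Definition re (R : realType) (k : scalar_kind) : scalar_field R k -> R :=
  match k with
  | RealScalars => fun x => x
  | ComplexScalars => @complex.Re R
  end.

Definition im (R : realType) (k : scalar_kind) : scalar_field R k -> R :=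
  match k with
  | RealScalars => fun=> 0
  | ComplexScalars => @complex.Im R
  end.

Definition ofR (R : realType) (k : scalar_kind) : R -> scalar_field R k :=
  match k with
  | RealScalars => fun x => x
  | ComplexScalars => fun x => Complex x 0
  end.
Arguments re {R k}.
Arguments im {R k}.
Arguments ofR {R} k.

(* MathComp norms on a K-normed space take values in K, not in R. *)
Definition rnorm (R : realType) (k : scalar_kind)
  (V : normedZmodType (scalar_field R k)) (x : V) : R := re `|x|.

Section scalar_theory.
Context (R : realType) (k : scalar_kind).
Local Notation K := (scalar_field R k).

Lemma ofRK (x : R) : re (ofR k x) = x.
Proof. by case: k. Qed.

Lemma reD (x y : K) : re (x + y) = re x + re y.
Proof. by case: k x y => //= -[a b] [c d]. Qed.

Lemma imD (x y : K) : im (x + y) = im x + im y.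
Proof. by case: k x y => [x y|[a b] [c d]] //=; rewrite addr0. Qed.

Lemma reM (x y : K) : re (x * y) = re x * re y - im x * im y.
Proof. by case: k x y => [x y|[a b] [c d]] //=; rewrite mul0r subr0. Qed.

Lemma imM (x y : K) : im (x * y) = re x * im y + im x * re y.
Proof.
case: k x y => [x y|[a b] [c d]] //=.
by rewrite mulr0 mul0r addr0.
Qed.

Lemma re0 : re (0 : K) = 0. Proof. by case: k. Qed.
Lemma im0 : im (0 : K) = 0. Proof. by case: k. Qed.

Lemma ofRD (x y : R) : ofR k (x + y) = ofR k x + ofR k y.
Proof. by case: k => //=; apply/eqP; rewrite eq_complex/= addr0 !eqxx. Qed.

Lemma ofRM (x y : R) : ofR k (x * y) = ofR k x * ofR k y.
Proof.
case: k => //=; apply/eqP.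
by rewrite eq_complex/= !(mulr0, mul0r, addr0, subr0) !eqxx.
Qed.

Lemma ler_ofR (x y : R) : (ofR k x <= ofR k y) = (x <= y).
Proof. by case: k => //=; rewrite lecE/= eqxx. Qed.

Lemma le_re (x y : K) : x <= y -> re x <= re y.
Proof. by case: k x y => //= x y; rewrite lecE => /andP[]. Qed.

Lemma ofR_norm (V : normedZmodType K) (x : V) : ofR k (rnorm x) = `|x|.
Proof.
rewrite /rnorm; move: `|x| (normr_ge0 x); case: k => //= -[a b].
by rewrite lecE/= => /andP[/eqP-> _].
Qed.

Lemma rnorm_ge0 (V : normedZmodType K) (x : V) : 0 <= rnorm x.
Proof.
by rewrite -(ler_ofR) ofR_norm; case: k V x => [|] V x /=; exact: normr_ge0.
Qed.

Lemma rnormD (V : normedZmodType K) (x y : V) :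
  rnorm (x + y) <= rnorm x + rnorm y.
Proof. by rewrite /rnorm -reD; exact/le_re/ler_normD. Qed.

Lemma rnormM (x y : K) : rnorm (x * y) = rnorm x * rnorm y.
Proof. by rewrite -[RHS](ofRK) ofRM !ofR_norm -normrM. Qed.

Lemma rnorm_eq0 (V : normedZmodType K) (x : V) : rnorm x = 0 -> x = 0.
Proof.
move=> x0; apply/eqP; rewrite -normr_eq0 -ofR_norm x0; apply/eqP.
by case: k.
Qed.

Lemma rnorm_reim (x : K) : rnorm x = Num.sqrt (re x ^+ 2 + im x ^+ 2).
Proof.
rewrite /rnorm; case: k x => [x|x] /=.
  by rewrite expr0n addr0 sqrtr_sqr.
by have /(congr1 (@complex.Re R)) := normc_def x.
Qed.

End scalar_theory.

Section operators.
Context (R : realType) (k : scalar_kind).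
Local Notation K := (scalar_field R k).

(* Only meaningful for T linear and continuous. *)
Definition opnorm (X Y : normedModType K) (T : X -> Y) : R :=
  sup [set rnorm (T x) | x in [set x | rnorm x <= 1]].

Definition rank_one (X Y : normedModType K) (T : X -> Y) : Prop :=
  exists2 u : Y, u != 0 & range T = [set a *: u | a in [set: K]].

End operators.

Record Iso (K : numFieldType) (X : normedModType K) := MkIso {
  iso_fun :> X -> X;
  iso_linear : linear iso_fun;
  iso_norm : forall x, `|iso_fun x| = `|x|;
  iso_surj : set_surj [set: X] [set: X] iso_fun
}.

Section iso_group.
Context (K : numFieldType) (X : normedModType K).
Implicit Types f g h : Iso X.

Lemma iso_ext f g : (f : X -> X) =1 g -> f = g.
Proof.
case: f g => [f fl fn fs] [g gl gn gs] /= /funext fg.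
by subst g; congr MkIso; exact: Prop_irrelevance.
Qed.

Lemma iso_inj f : injective f.
Proof.
move=> x y fxy; apply/eqP; rewrite -subr_eq0 -normr_eq0 -(iso_norm f).
have -> : x - y = (- 1) *: y + x by rewrite scaleN1r addrC.
by rewrite iso_linear scaleN1r fxy addNr normr0.
Qed.

Lemma iso_one_surj : set_surj [set: X] [set: X] idfun.
Proof. by move=> y _; exists y. Qed.

Definition iso_one : Iso X :=
  @MkIso K X idfun (fun _ _ _ => erefl) (fun=> erefl) iso_one_surj.

Lemma iso_mul_linear f g : linear (f \o g).
Proof. by move=> a x y /=; rewrite !iso_linear. Qed.

Lemma iso_mul_norm f g x : `|(f \o g) x| = `|x|.
Proof. by rewrite /= !iso_norm. Qed.

Lemma iso_mul_surj f g : set_surj [set: X] [set: X] (f \o g).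
Proof.
move=> y _; have [z _ <-] := iso_surj f (I : [set: X] y).
by have [x _ <-] := iso_surj g (I : [set: X] z); exists x.
Qed.

Definition iso_mul f g : Iso X :=
  MkIso (@iso_mul_linear f g) (@iso_mul_norm f g) (@iso_mul_surj f g).

Lemma iso_preim f y : {x | f x = y}.
Proof.
by apply: cid; have [x _ <-] := iso_surj f (I : [set: X] y); exists x.
Qed.

Definition iso_inv_fun f y : X := sval (iso_preim f y).

Lemma iso_inv_funK f : cancel (iso_inv_fun f) f.
Proof. by move=> y; exact: svalP (iso_preim f y). Qed.

Lemma iso_funK f : cancel f (iso_inv_fun f).
Proof. by move=> x; apply: (@iso_inj f); rewrite iso_inv_funK. Qed.

Lemma iso_inv_linear f : linear (iso_inv_fun f).
Proof.
by move=> a x y; apply: (@iso_inj f); rewrite iso_linear !iso_inv_funK.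
Qed.

Lemma iso_inv_norm f x : `|iso_inv_fun f x| = `|x|.
Proof. by rewrite -(iso_norm f) iso_inv_funK. Qed.

Lemma iso_inv_surj f : set_surj [set: X] [set: X] (iso_inv_fun f).
Proof. by move=> x _; exists (f x) => //; rewrite iso_funK. Qed.

Definition iso_inv f : Iso X :=
  MkIso (@iso_inv_linear f) (@iso_inv_norm f) (@iso_inv_surj f).

Lemma iso_mulA : associative iso_mul.
Proof. by move=> f g h; exact: iso_ext. Qed.

Lemma iso_mul1 : left_id iso_one iso_mul.
Proof. by move=> f; exact: iso_ext. Qed.

Lemma iso_mulr1 : right_id iso_one iso_mul.
Proof. by move=> f; exact: iso_ext. Qed.

Lemma iso_mulV : left_inverse iso_one iso_inv iso_mul.
Proof. by move=> f; apply: iso_ext => x /=; rewrite iso_funK. Qed.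

Lemma iso_mulrV : right_inverse iso_one iso_inv iso_mul.
Proof. by move=> f; apply: iso_ext => x /=; rewrite iso_inv_funK. Qed.

HB.instance Definition _ := gen_eqMixin (Iso X).
HB.instance Definition _ := gen_choiceMixin (Iso X).
HB.instance Definition _ := isGroup.Build (Iso X)
  iso_mulA iso_mul1 iso_mulr1 iso_mulV iso_mulrV.

End iso_group.

(* An action of G on X by surjective linear isometries is a group homomorphism *)
(* from G to Iso X; for the natural action of Iso X it is the identity.        *)

Section G_spaces.
Context (R : realType) (k : scalar_kind).
Local Notation K := (scalar_field R k).
Context (X : normedModType K) (G : groupType).
Variable rho : {multiplicative G -> Iso X}.

Definition G_numerical_radius (T : X -> X) : R :=
  sup [set r | exists (x : X) (f : {linear X -> K^o}) (g : G),
    [/\ rnorm x = 1, continuous f, opnorm f = 1, f x = 1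
      & r = re (f (T (rho g x)))]].

Definition G_numerical_index : R :=
  inf [set r | exists T : {linear X -> X},
    [/\ continuous T, opnorm T = 1 & r = G_numerical_radius T]].

Definition G_Daugavet : Prop :=
  forall T : {linear X -> X}, continuous T -> rank_one T ->
    sup [set opnorm (fun x => x + rho g (T x)) | g in [set: G]]
    = 1 + opnorm T.

End G_spaces.

Section Bochner.
Context (R : realType) (k : scalar_kind).
Local Notation K := (scalar_field R k).
Context d (Omega : measurableType d) (X : normedModType K).
Variable mu : {finite_measure set Omega -> \bar R}.

Definition simple_fun (s : Omega -> X) : Prop :=
  finite_set (range s) /\ forall x, measurable (s @^-1` [set x]).

Definition simple_integral (E : set Omega) (s : Omega -> X) : X :=
  \sum_(x \in range s) ofR k (fine (mu (E `&` s @^-1` [set x]))) *: x.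

(* Pointwise limits of simple functions everywhere and almost everywhere give *)
(* the same functions up to equality mu-almost everywhere.                    *)
Definition strongly_measurable (f : Omega -> X) : Prop :=
  exists2 s : nat -> Omega -> X, forall n, simple_fun (s n)
    & forall w, s ^~ w @ \oo --> f w.

Definition L1_approx (f : Omega -> X) (s : nat -> Omega -> X) : Prop :=
  (forall n, simple_fun (s n)) /\
  (fun n => \int[mu]_w (rnorm (f w - s n w))%:E)%E @ \oo --> 0%E.

Definition Bochner_integrable (f : Omega -> X) : Prop :=
  strongly_measurable f /\ exists s, L1_approx f s.

(* The limit does not depend on the approximating sequence. *)
Definition is_Bochner_integral (E : set Omega) (f : Omega -> X) (v : X) :=
  exists2 s, L1_approx f s & simple_integral E (s n) @[n --> \oo] --> v.

Definition vector_measure (F : set Omega -> X) : Prop :=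
  forall A : nat -> set Omega, (forall n, measurable (A n)) ->
    trivIset [set: nat] A ->
    series (fun n => F (A n)) @ \oo --> F (\bigcup_n A n).

Definition bounded_variation (F : set Omega -> X) : Prop :=
  exists M : R, forall (n : nat) (A : nat -> set Omega),
    (forall i, measurable (A i)) -> trivIset `I_n A ->
    \sum_(i < n) rnorm (F (A i)) <= M.

Definition mu_continuous (F : set Omega -> X) : Prop :=
  forall e : R, 0 < e -> exists2 dl : R, 0 < dl &
    forall E, measurable E -> (mu E < dl%:E)%E -> rnorm (F E) < e.

End Bochner.

Definition Radon_Nikodym_property (R : realType) (k : scalar_kind)
    (X : normedModType (scalar_field R k)) : Prop :=
  forall (d : measure_display) (Omega : measurableType d)
    (mu : {finite_measure set Omega -> \bar R}) (F : set Omega -> X),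
  vector_measure F -> bounded_variation F -> mu_continuous mu F ->
  exists2 f : Omega -> X, Bochner_integrable mu f &
    forall E, measurable E -> is_Bochner_integral mu E f (F E).

Section Lfunction.
Context (R : realType) (k : scalar_kind).
Local Notation K := (scalar_field R k).
Context d (Omega : measurableType d).
Variable mu : {measure set Omega -> \bar R}.
Variables (p : R) (p1 : 1 <= p).
Implicit Types f g : Omega -> K^o.

Definition Kmeasurable f : Prop :=
  measurable_fun [set: Omega] (re \o f) /\
  measurable_fun [set: Omega] (im \o f).

Definition Knorm f : \bar R := 'N[mu]_p%:E[(fun w => (rnorm (f w))%:E)]%E.

(* The proof of 1 <= p is an argument so that instances can be inferred. *)
Definition KLfun (_ : 1 <= p) : {pred (Omega -> K^o)} :=
  mem [set f | Kmeasurable f /\ (Knorm f < +oo)%E].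

Lemma measurable_rnorm f : Kmeasurable f ->
  measurable_fun [set: Omega] (fun w => rnorm (f w)).
Proof.
move=> [mre mim].
rewrite (_ : (fun w => _) = (fun w =>
  ((re (f w : K)) ^+ 2 + (im (f w : K)) ^+ 2) `^ 2^-1)); last first.
  apply/funext => w; rewrite powR12_sqrt ?addr_ge0 ?sqr_ge0//.
  exact: rnorm_reim.
apply: (@measurableT_comp _ _ _ _ _ _ (@powR R ^~ 2^-1)) => //.
by apply: measurable_funD; apply: measurable_funX.
Qed.

Lemma KmeasurableD f g : Kmeasurable f -> Kmeasurable g -> Kmeasurable (f + g).
Proof.
move=> [f1 f2] [g1 g2]; split.
- rewrite (_ : re \o _ = (re \o (f : Omega -> K)) \+ (re \o (g : Omega -> K))).
    exact: measurable_funD.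
  by apply/funext => w /=; rewrite -reD.
- rewrite (_ : im \o _ = (im \o (f : Omega -> K)) \+ (im \o (g : Omega -> K))).
    exact: measurable_funD.
  by apply/funext => w /=; rewrite -imD.
Qed.

Lemma KmeasurableZ (a : K) f : Kmeasurable f -> Kmeasurable (a *: f).
Proof.
move=> [f1 f2]; split.
- rewrite (_ : re \o _ = (fun w => re a * re (f w : K) - im a * im (f w : K))).
    by apply: measurable_funB; apply: measurable_funM.
  by apply/funext => w /=; rewrite -reM.
- rewrite (_ : im \o _ = (fun w => re a * im (f w : K) + im a * re (f w : K))).
    by apply: measurable_funD; apply: measurable_funM.
  by apply/funext => w /=; rewrite -imM.
Qed.

Lemma Kmeasurable0 : Kmeasurable (0 : Omega -> K^o).
Proof.
split.
- rewrite (_ : re \o _ = cst 0); first exact: measurable_cst.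
  by apply/funext => w /=; rewrite re0.
- rewrite (_ : im \o _ = cst 0); first exact: measurable_cst.
  by apply/funext => w /=; rewrite im0.
Qed.

Let p0 : 0 < p. Proof. exact: lt_le_trans p1. Qed.

Lemma KnormE f : Knorm f = ((\int[mu]_w (rnorm (f w) `^ p)%:E) `^ p^-1)%E.
Proof.
rewrite /Knorm unlock; congr (_ `^ _)%E; apply: eq_integral => w _ /=.
by rewrite ger0_norm ?rnorm_ge0.
Qed.

Lemma Knorm_ge0 f : (0 <= Knorm f)%E.
Proof. exact: Lnorm_ge0. Qed.

Let mpow f : Kmeasurable f ->
  measurable_fun [set: Omega] (fun w => (rnorm (f w) `^ p)%:E).
Proof.
move=> mf; apply/measurable_EFinP.
apply: (@measurableT_comp _ _ _ _ _ _ (@powR R ^~ p)) => //.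
exact: measurable_rnorm.
Qed.

Lemma KnormD f g : Kmeasurable f -> Kmeasurable g ->
  (Knorm (f + g)%R <= Knorm f + Knorm g)%E.
Proof.
move=> mf mg.
apply: le_trans (minkowski_EFin mu (measurable_rnorm mf) (measurable_rnorm mg)
  p1).
rewrite KnormE unlock; apply: gt0_ler_poweR.
- by rewrite invr_ge0 ltW.
- rewrite in_itv/= leey andbT; apply: integral_ge0 => w _.
  by rewrite lee_fin powR_ge0.
- rewrite in_itv/= leey andbT; apply: integral_ge0 => w _.
  by rewrite lee_fin powR_ge0.
apply: ge0_le_integral => //.
- by move=> w _; rewrite lee_fin powR_ge0.
- exact/mpow/KmeasurableD.
- apply/measurable_EFinP.
  apply: (@measurableT_comp _ _ _ _ _ _ (@powR R ^~ p)) => //.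
  apply: measurableT_comp => //.
  by apply: measurable_funD; exact: measurable_rnorm.
- move=> w _ /=; rewrite lee_fin ge0_ler_powR ?nnegrE ?rnorm_ge0// ?(ltW p0)//.
  by rewrite ger0_norm ?addr_ge0 ?rnorm_ge0// rnormD.
Qed.

Lemma KnormZ (a : K) f : Kmeasurable f ->
  Knorm (a *: f) = ((rnorm a)%:E * Knorm f)%E.
Proof.
move=> mf; rewrite !KnormE.
under eq_integral => w _.
  rewrite (_ : rnorm _ = rnorm a * rnorm (f w)); last exact: rnormM.
  rewrite powRM ?rnorm_ge0// EFinM.
  over.
rewrite ge0_integralZl_EFin ?powR_ge0//; last 2 first.
- by move=> w _; rewrite lee_fin powR_ge0.
- exact: mpow.
rewrite poweRM ?lee_fin ?powR_ge0//; last first.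
  by apply: integral_ge0 => w _; rewrite lee_fin powR_ge0.
by rewrite poweR_EFin -powRrM mulfV ?gt_eqF// powRr1 ?rnorm_ge0.
Qed.

Lemma Knorm0_ae f : Kmeasurable f -> Knorm f = 0%E ->
  {ae mu, forall w, f w = 0}.
Proof.
move=> mf /Lnorm_eq0_eq0 h.
have /h : measurable_fun [set: Omega] (fun w => (rnorm (f w))%:E).
  exact/measurable_EFinP/measurable_rnorm.
move=> /(_ p0); apply: filterS => w /(_ I) [] /rnorm_eq0; exact.
Qed.

Lemma Knorm_ae0 f : Kmeasurable f -> {ae mu, forall w, f w = 0} ->
  Knorm f = 0%E.
Proof.
move=> mf f0; rewrite KnormE.
rewrite (@ae_eq_integral _ _ _ _ setT (cst 0%E))//.
- by rewrite integral0 poweR0r// invr_eq0 gt_eqF.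
- exact: mpow.
- apply: filterS f0 => w fw0 _ /=; rewrite fw0 /rnorm normr0 re0.
  by rewrite powR0 ?gt_eqF.
Qed.

Lemma KLfun_submod_closed : submod_closed (KLfun p1).
Proof.
split.
  rewrite inE; split; first exact: Kmeasurable0.
  by rewrite Knorm_ae0//; [exact: Kmeasurable0|exact: aeW].
move=> a f g; rewrite !inE => -[mf ff] [mg gg].
have maf := KmeasurableZ a mf.
split; first exact: KmeasurableD.
apply: le_lt_trans (KnormD maf mg) _.
by rewrite lte_add_pinfty// KnormZ// lte_mul_pinfty// lee_fin rnorm_ge0.
Qed.

HB.instance Definition _ :=
  GRing.isSubmodClosed.Build K (Omega -> K^o) (KLfun p1)
  KLfun_submod_closed.

End Lfunction.

Section Lp.
Context (R : realType) (k : scalar_kind).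
Local Notation K := (scalar_field R k).
Context d (Omega : measurableType d).
Variable mu : {measure set Omega -> \bar R}.
Variables (p : R) (p1 : 1 <= p).

Record LpFun := MkLpFun {
  LpFun_val :> Omega -> K^o;
  LpFunP : LpFun_val \in KLfun mu p1
}.
HB.instance Definition _ := [isSub for LpFun_val].
HB.instance Definition _ := [Choice of LpFun by <:].
HB.instance Definition _ := [SubChoice_isSubLmodule of LpFun by <:].

Lemma LpFunB (f g : LpFun) w : (f - g) w = f w - g w.
Proof. by []. Qed.

Lemma LpFunZ (a : K) (f : LpFun) w : (a *: f) w = a *: f w.
Proof. by []. Qed.

Definition ae_null : {pred LpFun} :=
  mem [set f : LpFun | {ae mu, forall w, f w = 0}].

Lemma ae_null_zmod_closed : zmod_closed ae_null.
Proof.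
split; first by rewrite inE; exact: aeW.
move=> f g; rewrite !inE => f0 g0.
by apply: filterS2 f0 g0 => w fw gw; rewrite LpFunB fw gw subrr.
Qed.

HB.instance Definition _ := GRing.isZmodClosed.Build LpFun ae_null
  ae_null_zmod_closed.

Definition Lp : Type := (@Quotient.quot _ ae_null).
HB.instance Definition _ := GRing.Zmodule.on Lp.
HB.instance Definition _ := EqQuotient.on Lp.

Local Open Scope quotient_scope.

Lemma Lp_eqP (f g : LpFun) :
  \pi_Lp f = \pi_Lp g <-> {ae mu, forall w, f w = g w}.
Proof.
split=> [/eqP|fg].
  rewrite -Quotient.idealrBE inE; apply: filterS => w /eqP.
  by rewrite LpFunB subr_eq0 => /eqP.
apply/eqP; rewrite -Quotient.idealrBE inE.
by apply: filterS fg => w e; rewrite LpFunB e subrr.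
Qed.

Definition Lp_scale (a : K) (x : Lp) : Lp := \pi_Lp (a *: repr x).

Lemma Lp_scaleE (a : K) (f : LpFun) :
  Lp_scale a (\pi_Lp f) = \pi_Lp (a *: f).
Proof.
apply/Lp_eqP.
have /Lp_eqP : \pi_Lp (repr (\pi_Lp f)) = \pi_Lp f by rewrite reprK.
by apply: filterS => w e; rewrite !LpFunZ e.
Qed.

Lemma Lp_addE (f g : LpFun) : \pi_Lp (f + g) = \pi_Lp f + \pi_Lp g.
Proof. exact: Quotient.pi_add. Qed.

Lemma Lp_scalerA a b x : Lp_scale a (Lp_scale b x) = Lp_scale (a * b) x.
Proof.
elim/quotW: x => f.
by rewrite (Lp_scaleE b f) (Lp_scaleE a) (Lp_scaleE (a * b) f) scalerA.
Qed.

Lemma Lp_scale1r : left_id 1 Lp_scale.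
Proof. by move=> x; elim/quotW: x => f; rewrite Lp_scaleE scale1r. Qed.

Lemma Lp_scalerDr : right_distributive Lp_scale +%R.
Proof.
move=> a x y; elim/quotW: x => f; elim/quotW: y => g.
by rewrite -Lp_addE (Lp_scaleE a f) (Lp_scaleE a g) (Lp_scaleE a (f + g))
  scalerDr Lp_addE.
Qed.

Lemma Lp_scalerDl x : {morph Lp_scale^~ x : a b / a + b}.
Proof.
move=> a b; elim/quotW: x => f.
by rewrite (Lp_scaleE (a + b) f) (Lp_scaleE a f) (Lp_scaleE b f)
  scalerDl Lp_addE.
Qed.

HB.instance Definition _ := GRing.Zmodule_isLmodule.Build K Lp
  Lp_scalerA Lp_scale1r Lp_scalerDr Lp_scalerDl.

Definition Lp_norm (x : Lp) : R := fine (Knorm mu p (repr x)).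

Lemma LpFun_meas (f : LpFun) : Kmeasurable f.
Proof. by have := LpFunP f; rewrite inE => -[]. Qed.

Lemma LpFun_fin (f : LpFun) : Knorm mu p f \is a fin_num.
Proof.
rewrite ge0_fin_numE ?Knorm_ge0//.
by have := LpFunP f; rewrite inE => -[].
Qed.

Lemma Knorm_eq_ae (f g : LpFun) : {ae mu, forall w, f w = g w} ->
  Knorm mu p f = Knorm mu p g.
Proof.
move=> fg; apply/eqP; rewrite eq_le.
have le (f1 g1 : LpFun) : {ae mu, forall w, f1 w = g1 w} ->
    (Knorm mu p f1 <= Knorm mu p g1)%E.
  move=> fg1.
  rewrite -[in leLHS](subrK g1 f1).
  apply: (le_trans (KnormD mu p1 (LpFun_meas (f1 - g1)) (LpFun_meas g1))).
  rewrite Knorm_ae0// ?add0e//; first exact: LpFun_meas.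
  by apply: filterS fg1 => w e; rewrite LpFunB e subrr.
by rewrite !le//; apply: filterS fg => w.
Qed.

Lemma Lp_normE (f : LpFun) : Lp_norm (\pi_Lp f) = fine (Knorm mu p f).
Proof. by congr fine; apply/Knorm_eq_ae/Lp_eqP; rewrite reprK. Qed.

Lemma Lp_normD (x y : Lp) :
  ofR k (Lp_norm (x + y)) <= ofR k (Lp_norm x) + ofR k (Lp_norm y).
Proof.
rewrite -ofRD ler_ofR; elim/quotW: x => f; elim/quotW: y => g.
rewrite -Lp_addE !Lp_normE -lee_fin EFinD !fineK ?LpFun_fin//.
exact: (KnormD mu p1 (LpFun_meas f) (LpFun_meas g)).
Qed.

Lemma Lp_normZ (a : K) (x : Lp) :
  ofR k (Lp_norm (a *: x)) = `|a| * ofR k (Lp_norm x).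
Proof.
rewrite -ofR_norm -ofRM; congr ofR; elim/quotW: x => f.
rewrite [a *: _]Lp_scaleE !Lp_normE.
by rewrite (KnormZ mu p1 a (LpFun_meas f)) fineM ?LpFun_fin.
Qed.

Lemma Lp_norm0 (x : Lp) : ofR k (Lp_norm x) = 0 -> x = 0.
Proof.
move=> /(congr1 re); rewrite ofRK re0; elim/quotW: x => f.
rewrite Lp_normE => f0.
have -> : 0 = \pi_Lp 0 by rewrite raddf0.
apply/Lp_eqP; apply: (Knorm0_ae p1); first exact: LpFun_meas.
by rewrite -(fineK (LpFun_fin f)) f0.
Qed.

HB.instance Definition _ := Lmodule_isNormed.Build K Lp
  Lp_normD Lp_normZ Lp_norm0.

Lemma rnorm_Lp (f : LpFun) : rnorm (\pi_Lp f : Lp) =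
  fine ((\int[mu]_w (rnorm (f w) `^ p)%:E) `^ p^-1)%E.
Proof. by rewrite -KnormE -Lp_normE; exact: ofRK. Qed.

End Lp.

(* This measure lives on the line and is null outside [0, 1], so restricting *)
(* functions to [0, 1] identifies its L^p space with L^p[0,1].               *)
Definition lebesgue01 (R : realType) :
    {measure set (measurableTypeR R) -> \bar R} :=
  mrestr lebesgue_measure (measurable_itv `[0 : R, 1]).

Definition Lp01 (R : realType) (k : scalar_kind) (p : R) (p1 : 1 <= p) :
    normedModType (scalar_field R k) :=
  Lp k (lebesgue01 R) p1.

(* Main.v *)
Require Import Defs.
From HB Require Import structures.
From mathcomp Require Import all_boot all_order all_algebra.
From mathcomp Require Import finmap complex ring lra.
From mathcomp Require Import all_classical all_reals all_analysis.
From mathcomp Require Import measurable_realfun.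

Set Implicit Arguments.
Unset Strict Implicit.
Unset Printing Implicit Defensive.

Import Order.TTheory GRing.Theory Num.Theory.
Import numFieldNormedType.Exports.

Local Open Scope classical_set_scope.
Local Open Scope ring_scope.

(** Both parts rest on one criterion, numerical_radius_eq1: an operator T of
norm one has G-numerical radius one as soon as, for every e > 0, some y in the
unit ball satisfies |T y| > 1 - e and can be moved by G into almost the same
direction as any given unit vector x, in the sense that |x + g y| > 2 - e for
some g. Indeed let x = T y / |T y| and u = g y + a T y. Then u has norm almost
1 + a, while u - a T (g^-1 u) = g y - a^2 T (g^-1 (T y)) has norm at most
1 + a^2. A functional norming u shows that the second norm is at least
(1 - a v) times the first, where v is the numerical radius. For small a this
leaves no room for v < 1.

Let X have the G-Daugavet property and the Radon-Nikodym property, and suppose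
that no y is as required. Let y with |T y| > 1 - e fail for the unit vector x.
The Daugavet property provides, in every slice of the ball, a point v with
|x + g v| almost 2 for some g (Daugavet_slice); such a v is at distance at
least e / 2 from y. By the Hahn-Banach theorem y is thus a limit of averages of
points of the ball at distance at least e / 2 from y (Daugavet_average).
Starting from some y0 with |T y0| almost 1 and repeating this at each point
where |T y| > 1 - e gives a tree of points, that is an approximate martingale
of step functions on the unit interval, whose values of that kind all jump by
e / 2 at the next level.

The integrals of the step functions over a fixed Borel set converge, because
the conditional expectations of an indicator function converge in L2; the limit
is a vector measure dominated by the Lebesgue measure (tree_limit_measure). By
the Radon-Nikodym property it has a Bochner density, which is close in mean to
a simple function, and therefore the mean increment of the martingale from one
level to the next tends to zero (increments_small). But the mean of |T y| over
each level stays close to |T y0|, hence a fixed proportion of the values jump,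
a contradiction (Radon_Nikodym_Daugavet_point).

For L^p[0,1] every unit vector y that almost norms T will do, because the
isometries act almost transitively on the unit sphere
(Lp01_almost_transitive). If f has norm one and no zeros, and phi is the
distribution function of |f|^p, then u -> f (u o phi) is a surjective isometry
that sends the constant function 1 to f, since phi carries |f|^p dx to dx
(density_integral); and such f are dense in the sphere. *)

(** * Hahn-Banach theorem *)

Section Hahn_Banach.
Context (R : realType) (k : scalar_kind).
Local Notation K := (scalar_field R k).
Context (X : lmodType K).
Implicit Types (p q : X -> R) (x y : X) (W : set X).

Lemma ofR0 : ofR k (0 : R) = 0.
Proof. by case: k. Qed.

Lemma ofR1 : ofR k (1 : R) = 1.
Proof. by case: k. Qed.

Lemma ofRN (a : R) : ofR k (- a) = - ofR k a.
Proof. by apply/eqP; rewrite -addr_eq0 -ofRD addNr ofR0. Qed.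

Definition sublinear p :=
  (forall x y, p (x + y) <= p x + p y) /\
  (forall (t : R) x, 0 <= t -> p (ofR k t *: x) = t * p x).

Lemma sublinearI p : p 0 <= 0 -> (forall x y, p (x + y) <= p x + p y) ->
  (forall (t : R) x, 0 < t -> p (ofR k t *: x) <= t * p x) -> sublinear p.
Proof.
move=> p0 pD pZ; split=> // t x; rewrite le_eqVlt => /predU1P[<-|t0].
  rewrite ofR0 scale0r mul0r; apply/eqP; rewrite eq_le p0 /=.
  by rewrite -(lerD2l (p 0)) addr0 -[in leLHS](addr0 0).
apply/eqP; rewrite eq_le pZ //= -ler_pdivlMl //.
rewrite -[x in leLHS]scale1r -ofR1 -(mulVf (lt0r_neq0 t0)) ofRM -scalerA.
by rewrite pZ // invr_gt0.
Qed.

Lemma sublinear0 p : sublinear p -> p 0 = 0.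
Proof. by case=> _ /(_ 0 0 (lexx _)); rewrite ofR0 scale0r mul0r. Qed.

Lemma sublinear_oppr p x : sublinear p -> - p (- x) <= p x.
Proof.
move=> sp; rewrite -subr_ge0 opprK -(sublinear0 sp) -(subrr x).
exact: sp.1.
Qed.

(** Replacing p y by the infimum of p (y + t c) - t d over t >= 0 and c in W
lowers p just enough to detect that p is at least d on W: any linear
functional below the new p is at least d on W. Convexity of W enters only up
to an error measured by p, so that sets of averages over lists, which are
convex after closure only, qualify. *)
Lemma sublinear_push p W (d : R) : sublinear p -> W !=set0 ->
  (forall c, W c -> d <= p c) ->
  (forall c c' (t s e : R), W c -> W c' -> 0 <= t -> 0 <= s -> 0 < e ->
    exists2 b, W b &
      p (ofR k (t + s) *: b - (ofR k t *: c + ofR k s *: c')) <= e) ->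
  exists r, [/\ sublinear r, forall x, r x <= p x
    & forall c, W c -> r (- c) <= - d].
Proof.
move=> sp [c0 Wc0] dW convW; have [pD pZ] := sp.
pose V y := [set z | exists (t : R) c,
  [/\ 0 <= t, W c & z = p (y + ofR k t *: c) - t * d]].
have V0 y : V y !=set0.
  by exists (p (y + ofR k 0 *: c0) - 0 * d), 0, c0.
have lbV y : lbound (V y) (- p (- y)).
  move=> _ [t [c [t0 Wc ->]]]; rewrite lerBrDl lerBlDr.
  apply: (@le_trans _ _ (t * p c)); first by rewrite ler_wpM2l ?dW.
  rewrite -pZ // (le_trans _ (pD _ _)) //.
  by rewrite addrAC subrr add0r.
have hV y : has_lbound (V y) by exists (- p (- y)); exact: lbV.
pose r y := inf (V y).
have rle y t c : 0 <= t -> W c -> r y <= p (y + ofR k t *: c) - t * d.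
  by move=> t0 Wc; apply: ge_inf => //; exists t, c.
have rp y : r y <= p y.
  by rewrite (le_trans (rle y 0 c0 _ Wc0))// ofR0 scale0r addr0 mul0r subr0.
exists r; split=> //; last first.
  move=> c Wc; rewrite (le_trans (rle _ 1 c _ Wc))// ofR1 scale1r addNr mul1r.
  by rewrite sublinear0// sub0r.
apply: sublinearI.
- by rewrite (le_trans (rp _))// sublinear0.
- move=> x y; rewrite -lerBlDr; apply: lb_le_inf => // _ [t [c [t0 Wc ->]]].
  rewrite lerBlDr -lerBlDl; apply: lb_le_inf => // _ [s [c' [s0 Wc' ->]]].
  rewrite lerBlDl; apply/ler_addgt0Pr => e e0.
  have [b Wb be] := convW c c' t s e Wc Wc' t0 s0 e0.
  apply: (le_trans (rle _ (t + s) b _ Wb)); first exact: addr_ge0.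
  rewrite mulrDl opprD -!addrA [leRHS]addrCA !addrA -[leRHS]addrA lerBlDr.
  set x' := x + ofR k t *: c; set y' := y + ofR k s *: c'.
  set z := _ - _ in be.
  have -> : x + y + ofR k (t + s) *: b = x' + y' + z.
    by rewrite (addrACA x) -[RHS]addrA; congr (_ + _); rewrite [RHS]addrC subrK.
  by have := pD x' y'; have := pD (x' + y') z; lra.
- move=> t x t0; rewrite -ler_pdivrMl //; apply: lb_le_inf => // _ [s [c [s0 Wc ->]]].
  rewrite ler_pdivrMl //; apply: (le_trans (rle _ (t * s) c _ Wc)).
    by rewrite mulr_ge0 // ltW.
  by rewrite ofRM -scalerA -scalerDr (pZ _ _ (ltW t0)) mulrBr mulrA.
Qed.

(** The infimum of a chain of sublinear functionals below q is finite, because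
each of them is at least - q (- x) at x, so the Zorn lemma applies. *)
Lemma sublinear_minimal q : sublinear q -> exists p,
  [/\ sublinear p, forall x, p x <= q x
    & forall r, sublinear r -> (forall x, r x <= p x) -> r = p].
Proof.
move=> sq.
pose T := {p | sublinear p /\ forall x, p x <= q x}.
pose below (s t : T) := `[< forall x, sval t x <= sval s x >].
have [|||A tA|t tmin] := @Zorn T below.
- by move=> t; apply/asboolP.
- move=> r s t /asboolP rs /asboolP st; apply/asboolP => x.
  exact: le_trans (st x) (rs x).
- move=> [s Ps] [t Pt] /asboolP/= st /asboolP/= ts; apply: eq_exist.
  by apply/funext => x; apply/eqP; rewrite eq_le st ts.
- have [->|/set0P[s0 As0]] := eqVneq A set0.
    by exists (exist _ q (conj sq (fun x => lexx _))).
  pose V x := [set sval s x | s in A].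
  have V0 x : V x !=set0 by exists (sval s0 x), s0.
  have hV x : has_lbound (V x).
    exists (- q (- x)) => _ [[s [ss sleq]] As <-] /=.
    by rewrite (le_trans _ (sublinear_oppr x ss))// lerN2.
  pose p x := inf (V x).
  have ps s x : A s -> p x <= sval s x by move=> As; apply: ge_inf => //; exists s.
  have sp : sublinear p.
    apply: sublinearI.
    - by rewrite (le_trans (ps s0 _ As0))// sublinear0//; case: (svalP s0).
    - move=> x y; rewrite -lerBlDr; apply: lb_le_inf => // _ [s As <-].
      rewrite lerBlDr -lerBlDl; apply: lb_le_inf => // _ [t At <-].
      rewrite lerBlDl.
      have [/asboolP st|/asboolP ts] := tA _ _ As At.
      + apply: le_trans (ps t _ At) _; apply: le_trans (_ : _ <= sval t x + _) _.
          exact: (svalP t).1.1.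
        by rewrite lerD2r.
      + apply: le_trans (ps s _ As) _; apply: le_trans (_ : _ <= _ + sval s y) _.
          exact: (svalP s).1.1.
        by rewrite lerD2l.
    - move=> t x t0; rewrite -ler_pdivrMl //; apply: lb_le_inf => // _ [s As <-].
      rewrite ler_pdivrMl // -((svalP s).1.2 _ _ (ltW t0)); exact: ps.
  have pq x : p x <= q x by rewrite (le_trans (ps s0 x As0)) // (svalP s0).2.
  exists (exist _ p (conj sp pq)) => s As; apply/asboolP => x; exact: ps.
exists (sval t); split; [exact: (svalP t).1|exact: (svalP t).2|].
move=> r sr rt.
have rq x : r x <= q x by rewrite (le_trans (rt x)) // (svalP t).2.
by rewrite -(tmin (exist _ r (conj sr rq))) //; exact/asboolP.
Qed.

Definition real_linear (f : X -> R) :=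
  (forall x y, f (x + y) = f x + f y) /\
  (forall (t : R) x, f (ofR k t *: x) = t * f x).

(** A minimal sublinear functional is linear: pushing it down along a single
vector x leaves it unchanged, which says p (- x) <= - p x. *)
Theorem Hahn_Banach q : sublinear q ->
  exists2 f, real_linear f & forall x, f x <= q x.
Proof.
move=> /sublinear_minimal [p [sp pq pmin]]; exists p => //.
have pN x : p (- x) = - p x.
  have [|||r [sr rp /(_ x erefl)]] := @sublinear_push p [set x] (p x) sp.
  - by exists x.
  - by move=> _ ->.
  - move=> _ _ t s e -> -> _ _ e0; exists x => //.
    by rewrite -scalerDl -ofRD subrr sublinear0 // ltW.
  rewrite (pmin r sr rp) => px; apply/eqP; rewrite eq_le px /=.
  by rewrite lerNl sublinear_oppr.
have [pD pZ] := sp.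
split=> [x y|t x].
  apply/eqP; rewrite eq_le pD /= -[leRHS]opprK -pN opprD.
  by rewrite lerNr (le_trans (pD _ _))// !pN opprD.
have [t0|/ltW t0] := leP 0 t; first exact: pZ.
by rewrite -[t in LHS]opprK ofRN scaleNr pN pZ ?oppr_ge0// mulNr opprK.
Qed.

End Hahn_Banach.

(** * Real-valued norms and norming functionals *)

Section normed.
Context (R : realType) (k : scalar_kind).
Local Notation K := (scalar_field R k).

Lemma rnorm0 (V : normedZmodType K) : rnorm (0 : V) = 0.
Proof. by rewrite /rnorm normr0 re0. Qed.

Lemma rnormN (V : normedZmodType K) (x : V) : rnorm (- x) = rnorm x.
Proof. by rewrite /rnorm normrN. Qed.

Lemma rnormBC (V : normedZmodType K) (x y : V) : rnorm (x - y) = rnorm (y - x).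
Proof. by rewrite -rnormN opprB. Qed.

Lemma rnormB_ge (V : normedZmodType K) (x y : V) :
  rnorm x - rnorm y <= rnorm (x - y).
Proof. by rewrite lerBlDr -[in leLHS](subrK y x) rnormD. Qed.

Lemma rnormB_tri (V : normedZmodType K) (x y z : V) :
  rnorm (x - z) <= rnorm (x - y) + rnorm (y - z).
Proof. by rewrite -[in leLHS](subrK y x) -addrA rnormD. Qed.

Lemma rnorm_sum (V : normedZmodType K) (I : Type) (s : seq I) (P : pred I)
    (f : I -> V) :
  rnorm (\sum_(i <- s | P i) f i) <= \sum_(i <- s | P i) rnorm (f i).
Proof.
elim/big_rec2: _ => [|i y x _ yx]; first by rewrite rnorm0.
by rewrite (le_trans (rnormD _ _))// lerD2l.
Qed.

Lemma rnorm_ofR (t : R) : rnorm (ofR k t) = `|t|.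
Proof.
rewrite rnorm_reim ofRK (_ : im (ofR k t) = 0) ?expr0n ?addr0 ?sqrtr_sqr//.
by case: k.
Qed.

Lemma re_le_rnorm (a : K) : re a <= rnorm a.
Proof.
rewrite rnorm_reim (le_trans (ler_norm _))// -sqrtr_sqr ler_wsqrtr//.
by rewrite lerDl sqr_ge0.
Qed.

Lemma rnormZ (V : normedModType K) (a : K) (x : V) :
  rnorm (a *: x) = rnorm a * rnorm x.
Proof. by rewrite -[RHS](ofRK k) ofRM !ofR_norm -normrZ. Qed.

Lemma rnormZr (V : normedModType K) (t : R) (x : V) :
  rnorm (ofR k t *: x) = `|t| * rnorm x.
Proof. by rewrite rnormZ rnorm_ofR. Qed.

Lemma rnorm_gt0 (V : normedZmodType K) (x : V) : (0 < rnorm x) = (x != 0).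
Proof.
rewrite lt0r rnorm_ge0 andbT; congr (~~ _); apply/eqP/eqP => [/rnorm_eq0//|->].
exact: rnorm0.
Qed.

Lemma rnorm1 : rnorm (1 : K) = 1.
Proof. by rewrite -(ofR1 R k) rnorm_ofR normr1. Qed.

Lemma exists_phase (a : K) : exists2 u : K, rnorm u = 1 & u * a = ofR k (rnorm a).
Proof.
have [->|a0] := eqVneq a 0.
  by exists 1; rewrite ?rnorm1 // mulr0 rnorm0 ofR0.
exists (ofR k (rnorm a) / a); last by rewrite divfK.
have na : rnorm a != 0 by rewrite gt_eqF// rnorm_gt0.
apply: (mulIf na); rewrite -rnormM divfK// rnorm_ofR mul1r.
by rewrite ger0_norm// rnorm_ge0.
Qed.

(** Together with its converse below, this translates the continuity of
operators into bounds on the real-valued norm. *)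
Lemma bounded_continuous (X Y : normedModType K) (T : {linear X -> Y}) (M : R) :
  (forall x, rnorm (T x) <= M * rnorm x) -> continuous T.
Proof.
move=> TM; apply: bounded_linear_continuous; apply/linear_boundedP.
exists (ofR k `|M|); split.
  rewrite realE; apply/orP; left; rewrite -(ofR0 R k) ler_ofR; exact: normr_ge0.
move=> r Mr x; rewrite (@le_trans _ _ (ofR k `|M| * `|x|)) //; last first.
  by rewrite ler_wpM2r// ltW.
rewrite -!ofR_norm -ofRM ler_ofR (le_trans (TM x))// ler_wpM2r ?rnorm_ge0//.
exact: ler_norm.
Qed.

Lemma continuous_bounded (X Y : normedModType K) (T : {linear X -> Y}) :
  continuous T -> exists2 M : R, 0 <= M & forall x, rnorm (T x) <= M * rnorm x.
Proof.
move=> /(_ 0)/(@continuous_linear_bounded _ _ _ 0)/linear_boundedP/pinfty_ex_gt0.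
move=> [r r0 rT]; exists (rnorm r) => [|x]; first exact: rnorm_ge0.
rewrite -(ler_ofR k) ofRM !ofR_norm gtr0_norm//.
Qed.

Section dual.
Context (X : normedModType K).
Implicit Types (f : X -> R) (W : set X) (x : X).

Lemma functionalZ (F : {linear X -> K^o}) (a : K) x : F (a *: x) = a * F x.
Proof. exact: linearZ. Qed.

Lemma sublinear_rnorm : sublinear (k := k) (@rnorm R k X).
Proof.
split=> [x y|t x t0]; first exact: rnormD.
by rewrite rnormZr ger0_norm.
Qed.

(** The separation of 0 from an approximately convex set that stays at
distance d from it. *)
Lemma separation W (d : R) : W !=set0 -> (forall c, W c -> d <= rnorm c) ->
  (forall c c' (t s e : R), W c -> W c' -> 0 <= t -> 0 <= s -> 0 < e ->
    exists2 b : X, W b &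
      rnorm (ofR k (t + s) *: b - (ofR k t *: c + ofR k s *: c')) <= e) ->
  exists f, [/\ real_linear (k := k) f, forall x, f x <= rnorm x
    & forall c, W c -> d <= f c].
Proof.
move=> W0 dW convW.
have [r [sr rn rd]] := sublinear_push sublinear_rnorm W0 dW convW.
have [f [fD fZ] fr] := Hahn_Banach sr.
exists f; split=> // [x|c Wc]; first exact: le_trans (rn x).
rewrite -lerN2 (le_trans _ (rd _ Wc))// (le_trans _ (fr _))//.
rewrite -[c in leLHS]scale1r -(ofR1 R k) -mulN1r -fZ.
by rewrite ofRN ofR1 scale1r scaleN1r.
Qed.

(** Over the complex numbers the functional is f v - i f (i v). The bound on
its modulus follows from the one on its real part by rotating F x onto the
positive half-line. *)
Lemma complexify f : real_linear (k := k) f -> (forall x, f x <= rnorm x) ->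
  exists F : {linear X -> K^o}, [/\ continuous F, forall x, re (F x : K) = f x
   & forall x, rnorm (F x : K) <= rnorm x].
Proof.
move=> [fD fZ] fn.
suff [F FE] : exists F : {linear X -> K^o}, forall x, re (F x : K) = f x.
  have Fn x : rnorm (F x : K) <= rnorm x.
    have [u u1 uF] := exists_phase (F x : K).
    by have := fn (u *: x); rewrite -FE functionalZ rnormZ u1 mul1r uF ofRK.
  exists F; split=> //; apply: (@bounded_continuous _ _ _ 1) => x.
  by rewrite mul1r; exact: Fn.
have f0 : f 0 = 0 by apply: (addrI (f 0)); rewrite -fD !addr0.
have fN x : f (- x) = - f x by apply/eqP; rewrite -addr_eq0 -fD addNr f0.
have [F [FE FD FZ]] : exists F : X -> K^o, [/\ forall x, re (F x : K) = f x,
    forall x y, F (x + y) = F x + F y & forall a x, F (a *: x) = a *: F x].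
  case: k X f fD fZ fN {fn f0} => /= Y f fD fZ fN; first by exists f; split.
  exists (fun v => (f v +i* - f ('i%C *: v))%C : R[i]); split => // [v w|[a b] v].
    by apply/eqP; rewrite eq_complex /= scalerDr !fD opprD !eqxx.
  have E (c d : R) w : f ((c +i* d)%C *: w) = c * f w + d * f ('i%C *: w).
    have -> : (c +i* d)%C = Complex c 0 + Complex d 0 * 'i%C.
      apply/eqP; rewrite eq_complex /=.
      by rewrite !(mulr0, mulr1, mul0r, subr0, addr0, add0r) !eqxx.
    by rewrite scalerDl fD fZ -scalerA fZ.
  apply/eqP; rewrite eq_complex /= E scalerA.
  rewrite (_ : 'i%C * (a +i* b)%C = (- b +i* a)%C); last first.
    by apply/eqP; rewrite eq_complex /= !(mul0r, mul1r, sub0r, add0r) !eqxx.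
  rewrite (E (- b) a); apply/andP; split; apply/eqP; ring.
have lF : linear F by move=> a x y; rewrite FD FZ.
pose FL := GRing.isLinear.Build K X K^o *:%R F lF.
pose G : {linear X -> K^o} := HB.pack F FL.
by exists G.
Qed.

(** Separating 0 from the single point x gives re (F x) >= 1, and as the
modulus of F x is at most 1, the imaginary part vanishes. *)
Lemma norming_functional x : rnorm x = 1 ->
  exists F : {linear X -> K^o}, [/\ continuous F, F x = 1
   & forall x, rnorm (F x : K) <= rnorm x].
Proof.
move=> x1.
have [||c c' t s e -> -> _ _ e0|f [fl fn fx]] := @separation [set x] 1.
- by exists x.
- by move=> _ ->; rewrite x1.
- by exists x => //; rewrite -scalerDl -ofRD subrr rnorm0 ltW.
have [F [cF FE Fn]] := complexify fl fn.
exists F; split=> //.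
have re1 : 1 <= re (F x : K) by rewrite FE fx.
have := Fn x; rewrite x1 rnorm_reim => n1.
have : re (F x : K) ^+ 2 + im (F x : K) ^+ 2 <= 1.
  rewrite -[1](expr1n _ 2) -[leLHS]sqr_sqrtr ?addr_ge0 ?sqr_ge0//.
  by rewrite ler_sqr ?nnegrE// sqrtr_ge0.
have := sqr_ge0 (im (F x : K)).
have : 1 <= re (F x : K) ^+ 2.
  by rewrite -[1](expr1n _ 2) ler_sqr ?nnegrE// (le_trans _ re1).
move=> r2 i2 ri.
have im0 : im (F x : K) = 0 by apply/eqP; rewrite -sqrf_eq0; apply/eqP; lra.
have re1' : re (F x : K) = 1 by apply/eqP; rewrite eq_le re1 andbT; nra.
clear - im0 re1'; move: (F x : K) im0 re1'.
case: k => [a|[a b]] //= -> -> //.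
Qed.

End dual.

End normed.

(** * Numerical radius and numerical index *)

Section operator_norm.
Context (R : realType) (k : scalar_kind).
Local Notation K := (scalar_field R k).
Context (X Y : normedModType K).
Implicit Types (T : X -> Y) (M : R).

Let image_ball T := [set rnorm (T x) | x in [set x | rnorm x <= 1]].

Let image_ball_neq0 T : image_ball T !=set0.
Proof. by exists (rnorm (T 0)), 0 => //=; rewrite rnorm0 ler01. Qed.

Lemma opnorm_le T M : (forall x, rnorm x <= 1 -> rnorm (T x) <= M) ->
  opnorm T <= M.
Proof.
move=> TM; apply: ge_sup => [|_ [x x1 <-]]; last exact: TM.
exact: image_ball_neq0.
Qed.

Lemma opnorm_gt_ex T M : M < opnorm T ->
  exists2 x, rnorm x <= 1 & M < rnorm (T x).
Proof.
move=> MT; apply: contrapT => H; move: MT; apply/negP; rewrite -leNgt.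
apply: opnorm_le => x x1; rewrite leNgt; apply/negP => Mx; apply: H.
by exists x.
Qed.

Lemma opnorm_ge T M x : (forall y, rnorm (T y) <= M * rnorm y) ->
  rnorm x <= 1 -> rnorm (T x) <= opnorm T.
Proof.
move=> TM x1; apply: ub_le_sup; last by exists x.
exists `|M| => _ [y y1 <-]; rewrite (le_trans (TM y))//.
by rewrite (le_trans (ler_wpM2r (rnorm_ge0 _) (ler_norm M)))// ler_piMr.
Qed.

Lemma opnorm_bound (T : {linear X -> Y}) x : continuous T ->
  rnorm (T x) <= opnorm T * rnorm x.
Proof.
move=> /continuous_bounded[M M0 TM].
have [->|x0] := eqVneq x 0; first by rewrite linear0 !rnorm0 mulr0.
rewrite -rnorm_gt0 in x0; rewrite -ler_pdivrMr//.
have := @opnorm_ge T M (ofR k (rnorm x)^-1 *: x) TM.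
rewrite linearZ !rnormZr gtr0_norm ?invr_gt0// mulVf ?gt_eqF// mulrC; exact.
Qed.

End operator_norm.

Section scalars.
Context (R : realType) (k : scalar_kind).
Local Notation K := (scalar_field R k).

Lemma re_ofRM (a : R) (z : K) : re (ofR k a * z) = a * re z.
Proof.
by rewrite reM ofRK (_ : im (ofR k a) = 0) ?mul0r ?subr0//; case: k.
Qed.

Lemma reN (z : K) : re (- z) = - re z.
Proof. by apply/eqP; rewrite -addr_eq0 -reD addNr re0. Qed.

Lemma opnorm_norming (X : normedModType K) (f : {linear X -> K^o}) (x : X) :
  rnorm x = 1 -> f x = 1 -> (forall y, rnorm (f y : K) <= rnorm y) ->
  opnorm f = 1.
Proof.
move=> x1 fx fn; apply/eqP; rewrite eq_le; apply/andP; split.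
  by apply: opnorm_le => y; exact: le_trans.
have := @opnorm_ge _ _ _ _ f 1 x; rewrite fx rnorm1 x1; apply => // y.
by rewrite mul1r; exact: fn.
Qed.

Lemma rnorm_normalize (X : normedModType K) (x : X) : x != 0 ->
  rnorm (ofR k (rnorm x)^-1 *: x) = 1.
Proof.
rewrite -rnorm_gt0 => x0.
by rewrite rnormZr gtr0_norm ?invr_gt0// mulVf ?gt_eqF.
Qed.

End scalars.

Section numerical_index.
Context (R : realType) (k : scalar_kind).
Local Notation K := (scalar_field R k).
Context (X : normedModType K) (G : groupType).
Variable rho : {multiplicative G -> Iso X}.
Implicit Types (T : {linear X -> X}) (x y u : X) (g : G).

Lemma rnorm_iso (f : Iso X) x : rnorm (f x) = rnorm x.
Proof. by rewrite /rnorm iso_norm. Qed.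

Lemma isoD (f : Iso X) x y : f (x + y) = f x + f y.
Proof. by rewrite -[x in LHS]scale1r iso_linear scale1r. Qed.

Lemma iso0 (f : Iso X) : f 0 = 0.
Proof. by apply: (addrI (f 0)); rewrite -isoD !addr0. Qed.

Lemma isoZ (f : Iso X) (a : K) x : f (a *: x) = a *: f x.
Proof. by rewrite -[a *: x]addr0 iso_linear iso0 addr0. Qed.

Lemma rnorm_isoB (f : Iso X) x y : rnorm (f x - f y) = rnorm (x - y).
Proof. by rewrite -[RHS](rnorm_iso f) isoD -[- y]scaleN1r isoZ scaleN1r. Qed.

Lemma operatorD T x y : T (x + y) = T x + T y.
Proof. exact: linearD. Qed.

Lemma operatorZ T (a : K) x : T (a *: x) = a *: T x.
Proof. exact: linearZ. Qed.

Lemma actVK g x : rho (g^-1)%g (rho g x) = x.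
Proof.
have rhoM h h' z : rho (h * h')%g z = rho h (rho h' z) by rewrite gmulfM.
by rewrite -rhoM mulVg; apply: (@iso_inj _ _ (rho 1%g)); rewrite -rhoM mulg1.
Qed.

Let values T := [set r | exists (x : X) (f : {linear X -> K^o}) (g : G),
    [/\ rnorm x = 1, continuous f, opnorm f = 1, f x = 1
      & r = re (f (T (rho g x)))]].

Lemma numerical_value_le T r : continuous T -> opnorm T = 1 -> values T r ->
  r <= 1.
Proof.
move=> cT T1 [x [f [g [x1 cf f1 fx ->]]]].
rewrite (le_trans (re_le_rnorm _))//.
have := opnorm_bound (T (rho g x)) cf; rewrite f1 mul1r => /le_trans; apply.
by have := opnorm_bound (rho g x) cT; rewrite T1 mul1r rnorm_iso x1.
Qed.

Lemma numerical_radius_lower T g x (f : {linear X -> K^o}) :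
  continuous T -> opnorm T = 1 -> rnorm x = 1 -> continuous f ->
  f x = 1 -> (forall y, rnorm (f y : K) <= rnorm y) ->
  re (f (T (rho g x)) : K) <= G_numerical_radius rho T.
Proof.
move=> cT T1 x1 cf fx fn; apply: ub_le_sup.
  by exists 1 => r; exact: numerical_value_le.
by exists x, f, g; split=> //; exact: opnorm_norming x1 fx fn.
Qed.

Lemma numerical_radius_le1 T : (exists x : X, x != 0) ->
  continuous T -> opnorm T = 1 -> G_numerical_radius rho T <= 1.
Proof.
move=> [x x0] cT T1; apply: ge_sup; last by move=> r; exact: numerical_value_le.
have [f [cf fu fn]] := norming_functional (rnorm_normalize x0).
exists (re (f (T (rho 1%g (ofR k (rnorm x)^-1 *: x))) : K)).
exists (ofR k (rnorm x)^-1 *: x), f, 1%g; split=> //.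
  exact: rnorm_normalize.
exact: opnorm_norming (rnorm_normalize x0) fu fn.
Qed.

(** The Lumer estimate: a functional norming u sees u - a T (g u) with real
part at least (1 - a v) times the norm of u, where v is the radius. *)
Lemma numerical_radius_dissipative T g (a : R) u : 0 <= a ->
  continuous T -> opnorm T = 1 ->
  (1 - a * G_numerical_radius rho T) * rnorm u <=
  rnorm (u - ofR k a *: T (rho g u)).
Proof.
move=> a0 cT T1.
have [->|u0] := eqVneq u 0; first by rewrite rnorm0 mulr0 rnorm_ge0.
have [x x1 uE] : exists2 x, rnorm x = 1 & u = ofR k (rnorm u) *: x.
  exists (ofR k (rnorm u)^-1 *: u); first exact: rnorm_normalize.
  by rewrite scalerA -ofRM mulfV ?gt_eqF ?rnorm_gt0// ofR1 scale1r.
have [f [cf fx fn]] := norming_functional x1.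
have vx := numerical_radius_lower g cT T1 x1 cf fx fn.
have -> : u - ofR k a *: T (rho g u) =
    ofR k (rnorm u) *: (x - ofR k a *: T (rho g x)).
  by rewrite [in LHS]uE isoZ operatorZ scalerBr !scalerA [ofR k a * _]mulrC.
rewrite rnormZr ger0_norm ?rnorm_ge0// mulrC ler_wpM2l ?rnorm_ge0//.
rewrite (le_trans _ (fn _))// (le_trans _ (re_le_rnorm _))//.
have -> : re (f (x - ofR k a *: T (rho g x)) : K) =
    1 - a * re (f (T (rho g x)) : K).
  rewrite linearB fx functionalZ reD reN re_ofRM; congr (_ - _).
  by rewrite -(ofR1 R k) ofRK.
by rewrite lerD2l lerN2 ler_wpM2l.
Qed.

(** With x = T y / |T y| and a > 0 small, the vector u = g y + a T y has norm
close to 1 + a, whereas u - a T (g^-1 u) = g y - a^2 T (g^-1 (T y)) has norm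
at most 1 + a^2. The Lumer estimate then bounds (1 - a v) (1 + a) by
1 + a^2 up to a small error, which forces v close to 1. *)
Lemma numerical_radius_eq1 T : (exists x : X, x != 0) ->
  continuous T -> opnorm T = 1 ->
  (forall e : R, 0 < e -> exists y, [/\ rnorm y <= 1, 1 - e < rnorm (T y)
    & forall x, rnorm x = 1 -> exists g, 2 - e < rnorm (x + rho g y)]) ->
  G_numerical_radius rho T = 1.
Proof.
move=> X0 cT T1 HT; apply/eqP; rewrite eq_le numerical_radius_le1//=.
have Tn z : rnorm (T z) <= rnorm z by have := opnorm_bound z cT; rewrite T1 mul1r.
(* The tolerance is a^2, so that |u| >= 1 + a - a^2 - a^3; comparing with
   1 + a^2 and dividing by a leaves v >= 1 - 4 a. *)
have main (a : R) : 0 < a -> a <= 2^-1 -> 1 - 4 * a <= G_numerical_radius rho T.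
  move=> a0 a2.
  have [y [y1 Ty gy]] := HT (a ^+ 2) (exprn_gt0 _ a0).
  have t1 := le_trans (Tn y) y1.
  have Ty0 : T y != 0 by rewrite -rnorm_gt0; nra.
  have [g xg] := gy _ (rnorm_normalize Ty0).
  pose u := rho g y + ofR k a *: T y.
  have := numerical_radius_dissipative g^-1%g u (ltW a0) cT T1.
  have -> : u - ofR k a *: T (rho g^-1%g u) =
      rho g y - ofR k (a * a) *: T (rho g^-1%g (T y)).
    rewrite /u isoD actVK isoZ operatorD operatorZ scalerDr scalerA ofRM.
    by rewrite opprD addrA addrK.
  have := rnormD (rho g y) (- (ofR k (a * a) *: T (rho g^-1%g (T y)))).
  rewrite rnormN rnormZr rnorm_iso ger0_norm ?mulr_ge0 ?(ltW a0)//.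
  have := Tn (rho g^-1%g (T y)); rewrite rnorm_iso.
  have un : 1 - a ^+ 2 + a * rnorm (T y) <= rnorm u.
    set x := ofR k (rnorm (T y))^-1 *: T y in xg.
    have -> : u = (x + rho g y) - ofR k (1 - a * rnorm (T y)) *: x.
      rewrite ofRD ofRN scalerBl ofR1 scale1r /x [in X in _ - X]scalerA -ofRM.
      rewrite -[a * _ * _]mulrA mulfV ?gt_eqF ?rnorm_gt0// mulr1.
      by rewrite opprB addrCA addrAC subrr add0r /u addrC.
    have := rnormB_ge (x + rho g y) (ofR k (1 - a * rnorm (T y)) *: x).
    rewrite rnormZr rnorm_normalize// mulr1 ger0_norm; nra.
  have := numerical_radius_le1 X0 cT T1.
  move: (G_numerical_radius rho T) (rnorm (T y)) (rnorm y) (rnorm u) un Ty t1 y1.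
  move=> m t s n un Ty t1 y1 m1 H1 H2 H3.
  have H : (1 - a * m) * (1 + a - a ^+ 2 - a ^+ 3) <= 1 + a ^+ 2.
    have : (1 - a * m) * (1 + a - a ^+ 2 - a ^+ 3) <= (1 - a * m) * n.
      by apply: ler_wpM2l; nra.
    nra.
  have : a * (1 - 2 * a - a ^+ 2 - m * (1 + a - a ^+ 2 - a ^+ 3)) <= a * 0 by nra.
  rewrite ler_pM2l// => H'.
  have : m * (a - a ^+ 2 - a ^+ 3) <= 1 * (a - a ^+ 2 - a ^+ 3).
    by apply: ler_wpM2r => //; nra.
  nra.
rewrite leNgt; apply/negP; move: main; set m := G_numerical_radius rho T => main m1.
have m5 : 0 < (1 - m) / 5 by rewrite divr_gt0 ?subr_gt0.
have := main (Num.min 2^-1 ((1 - m) / 5)).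
rewrite lt_min ge_min lexx m5 invr_gt0 ltr0n => /(_ isT isT).
have : Num.min 2^-1 ((1 - m) / 5) <= (1 - m) / 5 by rewrite ge_min lexx orbT.
move: (Num.min _ _) => a; lra.
Qed.

(** The infimum defining the index is over a nonempty set, since the identity
has norm one. *)
Lemma numerical_index_eq1 : (exists x : X, x != 0) ->
  (forall T, continuous T -> opnorm T = 1 -> G_numerical_radius rho T = 1) ->
  G_numerical_index rho = 1.
Proof.
move=> [x x0] H.
have -> : G_numerical_index rho = inf [set 1].
  congr inf; apply/seteqP; split=> [r [T [cT T1 ->]]|_ ->] /=; first exact: H.
  have cid : continuous (idfun : {linear X -> X}) by move=> z; exact: cvg_id.
  have id1 : opnorm (idfun : {linear X -> X}) = 1.
    apply/eqP; rewrite eq_le opnorm_le//= -(rnorm_normalize x0).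
    apply: (@opnorm_ge _ _ _ _ idfun 1) => [y|]; first by rewrite mul1r.
    by rewrite rnorm_normalize.
  by exists idfun; split=> //; rewrite H.
exact: inf1.
Qed.

End numerical_index.

(** * The Daugavet property and averages of distant points *)

Section Daugavet_averages.
Context (R : realType) (k : scalar_kind).
Local Notation K := (scalar_field R k).
Context (X : normedModType K) (G : groupType).
Variable rho : {multiplicative G -> Iso X}.
Implicit Types (x y v : X) (g : G) (F : {linear X -> K^o}) (L : seq X).

(** The Daugavet property is tested on the rank-one operator
v -> F v x / |F|. The norm of v + g (F v x / |F|) can be close to 2 only if
the modulus of F v is almost |F|. Multiplying v by a scalar of modulus one makes
F v positive, so that v + g x has norm close to 2, and g^-1 carries this vector
to x + g^-1 v. *)
Lemma Daugavet_slice F x (eta : R) : G_Daugavet rho -> continuous F ->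
  0 < opnorm F -> rnorm x = 1 -> 0 < eta ->
  exists v g, [/\ rnorm v <= 1, opnorm F * (1 - eta) < re (F v : K)
    & 2 - eta < rnorm (x + rho g v)].
Proof.
move=> DP cF; set M := opnorm F => M0 x1 eta0.
have Mu : M != 0 by rewrite gt_eqF.
pose xM := ofR k M^-1 *: x.
have lT : linear (fun v => (F v : K) *: xM).
  have FD v w : (F (v + w) : K) = F v + F w by exact: linearD.
  by move=> a v w; rewrite FD functionalZ scalerDl -scalerA.
pose TL := GRing.isLinear.Build K X X *:%R _ lT.
pose T : {linear X -> X} := HB.pack (fun v => (F v : K) *: xM) TL.
have nT v : rnorm (T v) = rnorm (F v : K) / M.
  by rewrite /= rnormZ rnormZr x1 mulr1 gtr0_norm ?invr_gt0.
have Fb v : rnorm (F v : K) <= M * rnorm v by exact: opnorm_bound.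
have Tb v : rnorm (T v) <= 1 * rnorm v.
  by rewrite nT mul1r ler_pdivrMr// mulrC Fb.
have cT : continuous T := bounded_continuous Tb.
have T1 : opnorm T = 1.
  apply/eqP; rewrite eq_le; apply/andP; split.
    by apply: opnorm_le => v v1; rewrite (le_trans (Tb _))// mul1r.
  rewrite leNgt; apply/negP => T1.
  have : opnorm T * M < M by rewrite gtr_pMl.
  move=> /opnorm_gt_ex[v v1]; apply/negP; rewrite -leNgt.
  by rewrite -ler_pdivrMr// -nT; exact: opnorm_ge Tb v1.
have rT : rank_one T.
  exists xM.
    by rewrite -rnorm_gt0 rnormZr x1 mulr1 normr_gt0 invr_eq0.
  have [v0 _ v00] := opnorm_gt_ex M0; rewrite rnorm_gt0 in v00.
  apply/seteqP; split=> [_ [v _ <-]|_ [a _ <-]]; first by exists (F v).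
  by exists ((a / F v0) *: v0) => //=; rewrite functionalZ divfK.
have := DP T cT rT; rewrite T1 => D2.
have [g gT] : exists g, 2 - eta / 2 < opnorm (fun v => v + rho g (T v)).
  apply: contrapT => H.
  have : sup [set opnorm (fun x => x + rho g (T x)) | g in [set: G]] <= 2 - eta / 2.
    apply: ge_sup; first by exists (opnorm (fun x => x + rho 1%g (T x))), 1%g.
    by move=> _ [g _ <-]; rewrite leNgt; apply/negP => gT; apply: H; exists g.
  by rewrite D2; lra.
have [v v1 vT] := opnorm_gt_ex gT.
have [u u1 uF] := exists_phase (F v : K).
have Fn : rnorm (F v : K) / M <= 1.
  by rewrite -nT (le_trans (Tb _))// mul1r.
have Fl : 1 - eta / 2 < rnorm (F v : K) / M.
  have := rnormD v (rho g (T v)); rewrite rnorm_iso nT; lra.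
exists (u *: v), g^-1%g; split.
- by rewrite rnormZ u1 mul1r.
- rewrite functionalZ uF ofRK mulrC -ltr_pdivlMr//; lra.
- have -> : rnorm (x + rho g^-1%g (u *: v)) = rnorm (u *: v + rho g x).
    by rewrite -[RHS](rnorm_iso (rho g^-1%g)) isoD actVK addrC.
  have -> : u *: v + rho g x = u *: (v + rho g (T v)) +
      ofR k (1 - rnorm (F v : K) / M) *: rho g x.
    rewrite scalerDr /= !isoZ !scalerA uF -ofRM ofRD ofRN scalerBl ofR1 scale1r.
    by rewrite -!addrA (addrCA (_ *: rho g x)) subrr addr0.
  have := rnormB_ge (u *: (v + rho g (T v)))
    (- (ofR k (1 - rnorm (F v : K) / M) *: rho g x)).
  rewrite opprK rnormN rnormZ u1 mul1r rnormZr rnorm_iso x1 mulr1.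
  rewrite ger0_norm ?subr_ge0//; lra.
Qed.

(** Averages over lists, with repetitions, play the part of convex
combinations with rational weights: lists are what the splitting into
equally long intervals needs. *)
Definition average L : X := ofR k (size L)%:R^-1 *: \sum_(z <- L) z.

Definition far y (d : R) : set X := [set z | rnorm z <= 1 /\ d <= rnorm (z - y)].

(** Repeating each list a number of times proportional to the length of the
other one gives both the same total weight. *)
Lemma average_mix L L' (p q : nat) : (0 < size L)%N -> (0 < size L')%N ->
  (0 < p + q)%N ->
  average (flatten (nseq (p * size L') L) ++ flatten (nseq (q * size L) L')) =
  ofR k (p%:R / (p + q)%:R) *: average L + ofR k (q%:R / (p + q)%:R) *: average L'.
Proof.
move=> L0 L'0 pq.
have S n (s : seq X) : \sum_(z <- flatten (nseq n s)) z = ofR k n%:R *: \sum_(z <- s) z.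
  elim: n => [|n IH] /=; first by rewrite big_nil ofR0 scale0r.
  by rewrite big_cat /= IH -[in RHS]addn1 natrD ofRD scalerDl ofR1 scale1r addrC.
have Z n (s : seq X) : size (flatten (nseq n s)) = (n * size s)%N.
  by rewrite size_flatten /shape map_nseq sumn_nseq mulnC.
rewrite /average big_cat size_cat !S !Z /= scalerDr !scalerA -!ofRM.
have a0 : (size L)%:R != 0 :> R by rewrite pnatr_eq0 -lt0n.
have b0 : (size L')%:R != 0 :> R by rewrite pnatr_eq0 -lt0n.
have c0 : p%:R + q%:R != 0 :> R by rewrite -natrD pnatr_eq0 -lt0n.
rewrite !(natrD, natrM).
have -> : p%:R * (size L')%:R * (size L)%:R + q%:R * (size L)%:R * (size L')%:R
    = (size L)%:R * (size L')%:R * (p%:R + q%:R) :> R by ring.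
by congr (ofR k _ *: _ + ofR k _ *: _); field; rewrite ?a0 ?b0 ?c0.
Qed.

Lemma rational_weight (t s e : R) : 0 <= t -> 0 <= s -> 0 < e ->
  exists p q : nat, (0 < p + q)%N /\ `|(t + s) * (p%:R / (p + q)%:R) - t| <= e.
Proof.
move=> t0 s0 e0.
have [ts0|ts0] := eqVneq (t + s) 0.
  exists 1, 0; split=> //; rewrite ts0 mul0r sub0r normrN ger0_norm//.
  by rewrite (_ : t = 0) ?ltW//; lra.
have ts : 0 < t + s by rewrite lt_neqAle eq_sym ts0 addr_ge0.
pose N := (Num.truncn ((t + s) / e)).+1.
have N0 : 0 < N%:R :> R by rewrite ltr0n.
pose p := Num.truncn (N%:R * t / (t + s)).
have x0 : 0 <= N%:R * t / (t + s) by rewrite divr_ge0 ?mulr_ge0 ?(ltW ts) ?(ltW N0).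
have /andP[pl pu] := truncn_itv x0.
have pN : (p <= N)%N.
  by rewrite -(ler_nat R) (le_trans pl)// ler_pdivrMr// ler_wpM2l ?(ltW N0)// lerDl.
exists p, (N - p)%N; rewrite subnKC//; split=> //.
have eN : (t + s) / N%:R <= e.
  rewrite ler_pdivrMr// mulrC -ler_pdivrMr// ltW//.
  by have := truncnS_gt ((t + s) / e).
have -> : (t + s) * (p%:R / N%:R) - t = - ((t + s) / N%:R * (N%:R * t / (t + s) - p%:R)).
  by field; rewrite ts0 gt_eqF.
rewrite normrN ger0_norm ?mulr_ge0 ?subr_ge0 ?invr_ge0 ?(ltW ts)// ?(ltW N0)//.
rewrite (le_trans _ eN)// ler_piMr ?divr_ge0 ?(ltW ts)// ?(ltW N0)//.
by move: pu; rewrite -/p -natr1; lra.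
Qed.

(** Every point of a slice provided by Daugavet_slice for x is far from y,
since x + g y stays away from norm 2. Hence no functional separates y from
the averages of far points. *)
Lemma Daugavet_average y x (d e : R) : G_Daugavet rho -> rnorm y <= 1 ->
  rnorm x = 1 -> 0 < d -> (forall g, rnorm (x + rho g y) <= 2 - d) -> 0 < e ->
  exists L, [/\ (0 < size L)%N, forall z, z \in L -> far y (d / 2) z
    & rnorm (average L - y) <= e].
Proof.
move=> DP y1 x1 d0 xy e0; apply: contrapT => noL.
have farP v g : rnorm v <= 1 -> 2 - d / 2 < rnorm (x + rho g v) -> far y (d / 2) v.
  move=> v1 xv; split=> //.
  have := rnormD (x + rho g y) (rho g (v - y)).
  by rewrite -addrA -isoD (addrC y) subrK rnorm_iso; have := xy g; lra.
have opF f (F : {linear X -> K^o}) : (forall z, re (F z : K) = f z) ->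
    continuous F -> (exists z, f z != 0) -> 0 < opnorm F.
  move=> FE cF [z fz]; rewrite lt_neqAle; apply/andP; split; last first.
    rewrite (le_trans (rnorm_ge0 (F 0 : K)))//.
    have [M M0 FM] := continuous_bounded cF.
    by apply: (opnorm_ge FM); rewrite rnorm0.
  apply/eqP => F0; have := opnorm_bound z cF; rewrite -F0 mul0r => Fz.
  have /rnorm_eq0 Fz0 : rnorm (F z : K) = 0.
    by apply/eqP; rewrite eq_le Fz rnorm_ge0.
  by move: fz; rewrite -FE Fz0 re0 eqxx.
pose U := [set u | exists L, [/\ (0 < size L)%N, forall z, z \in L -> far y (d / 2) z
  & u = average L - y]].
have farU z : far y (d / 2) z -> U (z - y).
  exists [:: z]; split=> // [w|]; first by rewrite inE => /eqP ->.
  by rewrite /average big_seq1 invr1 ofR1 scale1r.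
have d2 : 0 < d / 2 by rewrite divr_gt0.
have [z0 fz0] : exists z, far y (d / 2) z.
  have [F [cF Fx Fn]] := norming_functional x1.
  have F1 : 0 < opnorm F by rewrite (opnorm_norming x1 Fx Fn).
  have [v [g [v1 _ xv]]] := Daugavet_slice DP cF F1 x1 d2.
  by exists v; exact: farP v1 xv.
(* f is at least e on all differences between averages of far points and y,
   so the slice of - f close to its maximum contains no far point. *)
have [f [fl fn fU]] : exists f, [/\ real_linear (k := k) f,
    forall x, f x <= rnorm x & forall c, U c -> e <= f c].
  apply: separation.
  - by exists (z0 - y); exact: farU.
  - move=> _ [L [L0 fL ->]]; rewrite leNgt; apply/negP => Le; apply: noL.
    by exists L; split=> //; exact: ltW.
  - move=> _ _ t s r [L [L0 fL ->]] [L' [L'0 fL' ->]] t0 s0 r0.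
    set c := average L - y; set c' := average L' - y.
    have n0 : 0 < rnorm c + rnorm c' + 1.
      by rewrite ltr_wpDl// addr_ge0 ?rnorm_ge0.
    have [p [q [pq wt]]] := rational_weight t0 s0 (divr_gt0 r0 n0).
    exists (average (flatten (nseq (p * size L') L) ++
       flatten (nseq (q * size L) L')) - y).
      eexists; split; [| |reflexivity].
      + rewrite size_cat !size_flatten /shape !map_nseq !sumn_nseq.
        case: p q pq {wt} => [|p] [|q] // _;
        by rewrite ?addn_gt0 ?muln_gt0 L0 L'0 ?orbT.
      + move=> z; rewrite mem_cat => /orP[] /flattenP[s' /nseqP[-> _]];
          [exact: fL|exact: fL'].
    rewrite average_mix//.
    have pqE : p%:R / (p + q)%:R = 1 - q%:R / (p + q)%:R :> R.
      by rewrite natrD; field; rewrite -natrD pnatr_eq0 -lt0n.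
    set w := p%:R / (p + q)%:R in wt pqE *.
    have -> : q%:R / (p + q)%:R = 1 - w by rewrite pqE opprB addrC subrK.
    have -> : ofR k w *: average L + ofR k (1 - w) *: average L' - y =
        ofR k w *: c + ofR k (1 - w) *: c'.
      rewrite !scalerBr addrACA -opprD -scalerDl -ofRD.
      by rewrite [w + _]addrC subrK ofR1 scale1r.
    have -> : ofR k (t + s) *: (ofR k w *: c + ofR k (1 - w) *: c') -
        (ofR k t *: c + ofR k s *: c') =
        ofR k ((t + s) * w - t) *: c + ofR k (t - (t + s) * w) *: c'.
      rewrite scalerDr !scalerA -!ofRM opprD addrACA -!scalerBl -!ofRN -!ofRD.
      by congr (_ + ofR k _ *: _); ring.
    rewrite (le_trans (rnormD _ _))// !rnormZr (distrC t) -mulrDr.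
    rewrite (le_trans (ler_wpM2r _ wt)) ?addr_ge0 ?rnorm_ge0//.
    rewrite -mulrA ler_piMr ?ltW//.
    by rewrite mulrC ltr_pdivrMr// mul1r ltrDl.
have [fD fZ] := fl.
have fN z : f (- z) = - f z.
  by rewrite -scaleN1r -(ofR1 R k) -ofRN fZ mulN1r.
have f'l : real_linear (k := k) (fun z => f (- z)).
  by split=> [z w|t z]; rewrite ?opprD ?fD// -scalerN fZ.
have f'n z : f (- z) <= rnorm z by rewrite -(rnormN z).
have [F [cF FE Fn]] := complexify f'l f'n.
have {}fz0 := fU _ (farU _ fz0).
have F0 : 0 < opnorm F.
  apply: (opF _ _ FE cF); exists (- (z0 - y)).
  by rewrite opprK gt_eqF// (lt_le_trans e0).
have F1 : opnorm F <= 1 by apply: opnorm_le => z z1; exact: le_trans (Fn z) z1.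
pose eta := Num.min (d / 2) e.
have eta0 : 0 < eta by rewrite lt_min divr_gt0.
have [v [g [v1 Fv xv]]] := Daugavet_slice DP cF F0 x1 eta0.
have etad : eta <= d / 2 by rewrite ge_min lexx.
have etae : eta <= e by rewrite ge_min lexx orbT.
have fv : e <= f (v - y).
  by apply/fU/farU/(farP _ g) => //; apply: le_lt_trans xv; rewrite lerD2l lerN2.
have : re (F y : K) <= opnorm F.
  rewrite (le_trans (re_le_rnorm _))// (le_trans (opnorm_bound y cF))//.
  by rewrite ler_piMr// ltW.
move: Fv; rewrite !FE !fN => Fv Fy; move: fv; rewrite fD fN => fv.
have : opnorm F * eta <= 1 * eta by rewrite ler_wpM2r// ltW.
lra.
Qed.

End Daugavet_averages.

(** * Trees of points of the unit ball *)

Section splitting_sums.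
Context (R : realType) (k : scalar_kind).
Local Notation K := (scalar_field R k).

Lemma sum_blocks (V : nmodType) (n m : nat) (f : nat -> V) :
  \sum_(i < n * m) f i = \sum_(i < n) \sum_(j < m) f (i * m + j)%N.
Proof.
elim: n => [|n IH]; first by rewrite mul0n !big_ord0.
by rewrite big_ord_recr /= -IH mulSnr big_split_ord.
Qed.

(** If w lists the masses of a set in n cells of mass 1/n, this is the squared
L2 norm of the conditional expectation of its indicator function. *)
Definition energy (n : nat) (w : nat -> R) : R := n%:R * \sum_(i < n) w i ^+ 2.

(** The Pythagorean identity for refining a partition into n equal cells to
one into n * m. *)
Lemma energy_blocks (n m : nat) (v w : nat -> R) : (0 < m)%N ->
  (forall i, (i < n)%N -> v i = \sum_(j < m) w (i * m + j)%N) ->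
  (n * m)%:R * \sum_(i < n) \sum_(j < m) (w (i * m + j)%N - v i / m%:R) ^+ 2
    = energy (n * m) w - energy n v.
Proof.
move=> m0 vw; have m0R : m%:R != 0 :> R by rewrite pnatr_eq0 -lt0n.
rewrite /energy (sum_blocks n m (fun i => w i ^+ 2)) natrM -!mulrA -mulrBr.
congr (_ * _); rewrite !mulr_sumr -sumrB; apply: eq_bigr => i _.
set c := v i / m%:R.
rewrite (eq_bigr (fun j : 'I_m => w (i * m + j)%N ^+ 2 +
  (- 2 * c) * w (i * m + j)%N + c ^+ 2)); last by move=> j _; ring.
rewrite !big_split /= -mulr_sumr -vw// sumr_const card_ord -mulr_natr /c.
by field.
Qed.

(** The inequality between arithmetic and geometric means, term by term,
trades the L1 deviation for the L2 one. *)
Lemma deviation_le (n m : nat) (v w : nat -> R) (s : R) : (0 < m)%N ->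
  0 < s ->
  (forall i, (i < n)%N -> v i = \sum_(j < m) w (i * m + j)%N) ->
  \sum_(i < n) \sum_(j < m) `|w (i * m + j)%N - v i / m%:R| <=
  s / 2 + (energy (n * m) w - energy n v) / (2 * s).
Proof.
move=> m0 s0 vw.
have [->|n0] := posnP n.
  by rewrite !big_ord0 /energy mul0n !mul0r subr0 mul0r addr0 divr_ge0 ?ltW.
have N0 : 0 < (n * m)%:R :> R by rewrite ltr0n muln_gt0 n0.
rewrite -(energy_blocks m0 vw).
have -> : s / 2 = \sum_(i < n) \sum_(j < m) s / (2 * (n * m)%:R).
  under eq_bigr do rewrite sumr_const card_ord.
  rewrite sumr_const card_ord -mulrnA mulnC -mulr_natr; field.
  by rewrite !pnatr_eq0 -!lt0n n0.
rewrite mulr_sumr mulr_suml -big_split /=; apply: ler_sum => i _.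
rewrite mulr_sumr mulr_suml -big_split /=; apply: ler_sum => j _.
set x := w _ - _; set N := _%:R in N0 *; clearbody N x.
have : 0 <= (`|x| - s / N) ^+ 2 * (N / (2 * s)).
  by rewrite mulr_ge0 ?sqr_ge0// divr_ge0 ?mulr_ge0 ?ltW.
have -> : (`|x| - s / N) ^+ 2 * (N / (2 * s)) =
    `|x| ^+ 2 * N / (2 * s) - `|x| + s / (2 * N).
  by field; rewrite !gt_eqF.
rewrite real_normK ?num_real// [_ * N]mulrC; lra.
Qed.

(** Bounds the right-hand side of deviation_le once the energies have
stabilised up to s^2. *)
Lemma half_square (s q : R) : 0 < s -> q <= s ^+ 2 -> s / 2 + q / (2 * s) <= s.
Proof.
move=> s0 qs; have : q / (2 * s) <= s / 2 by rewrite ler_pdivrMr ?mulr_gt0//; nra.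
lra.
Qed.

End splitting_sums.

Section tree.
Context (R : realType) (k : scalar_kind).
Local Notation K := (scalar_field R k).
Context (X : normedModType K).
Implicit Types (y z : X) (L : seq X).

Definition block_average (m : nat) (Z : nat -> X) : X :=
  ofR k m%:R^-1 *: \sum_(j < m) Z j.

Lemma average_nth L (Z : nat -> X) :
  (forall j, (j < size L)%N -> Z j = nth 0 L j) ->
  block_average (size L) Z = average L.
Proof.
move=> ZL; rewrite /block_average /average (big_nth 0) big_mkord.
by congr (_ *: _); apply: eq_bigr => j _; exact: ZL.
Qed.

Lemma average_repeat L (n : nat) : (0 < n)%N ->
  average (flatten (nseq n L)) = average L.
Proof.
move=> n0; rewrite /average size_flatten /shape map_nseq sumn_nseq.
have -> : \sum_(z <- flatten (nseq n L)) z = ofR k n%:R *: \sum_(z <- L) z.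
  elim: n {n0} => [|n IH] /=; first by rewrite big_nil ofR0 scale0r.
  by rewrite big_cat /= IH -[in RHS]addn1 natrD ofRD scalerDl ofR1 scale1r addrC.
rewrite scalerA -ofRM natrM invfM -mulrA mulVf ?mulr1// pnatr_eq0 -lt0n//.
Qed.

Variables (D : set X) (dl : R).
Hypothesis splits : forall y (e : R), rnorm y <= 1 -> D y -> 0 < e ->
  exists L, [/\ (0 < size L)%N, forall z, z \in L -> far y dl z
    & rnorm (average L - y) <= e].

(** Each point of the level is replaced by a list averaging to it: a list of
distant points for those in D, the point itself for the others. Repeating
the lists equalises their lengths, here to the product of all of them, so
that every interval can be cut into the same number of equal parts. *)
Lemma refine_level (N : nat) (Y : nat -> X) (e : R) : 0 < e ->
  (forall i, (i < N)%N -> rnorm (Y i) <= 1) ->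
  exists mZ : nat * (nat -> X), [/\ (0 < mZ.1)%N,
    forall i, (i < N * mZ.1)%N -> rnorm (mZ.2 i) <= 1
  & forall i, (i < N)%N ->
      rnorm (block_average mZ.1 (fun j => mZ.2 (i * mZ.1 + j)%N) - Y i) <= e /\
      (D (Y i) -> forall j, (j < mZ.1)%N ->
        dl <= rnorm (mZ.2 (i * mZ.1 + j)%N - Y i))].
Proof.
move=> e0 Y1.
have /choice[L LP] : forall i, exists L, (i < N)%N -> [/\ (0 < size L)%N,
    forall z, z \in L -> rnorm z <= 1 /\ (D (Y i) -> dl <= rnorm (z - Y i))
    & rnorm (average L - Y i) <= e].
  move=> i; have [iN|iN] := ltnP i N; last by exists [::].
  have [DY|DY] := pselect (D (Y i)).
    have [L [L0 fL Le]] := splits (Y1 i iN) DY e0.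
    by exists L => _; split=> // z /fL[].
  exists [:: Y i] => _; split=> // [z|].
    by rewrite inE => /eqP ->; split=> //; exact: Y1.
  by rewrite /average big_seq1 invr1 ofR1 scale1r subrr rnorm0 ltW.
pose m := (\prod_(i < N) size (L i))%N.
have m0 : (0 < m)%N.
  by rewrite /m prodn_cond_gt0// => i _; have [] := LP i (ltn_ord i).
pose LL i := flatten (nseq (m %/ size (L i))%N (L i)).
have LLs i : (i < N)%N -> size (LL i) = m.
  move=> iN; rewrite size_flatten /shape map_nseq sumn_nseq mulnC divnK//.
  by rewrite /m (bigD1 (Ordinal iN)) //= dvdn_mulr.
pose Z n := nth 0 (LL (n %/ m)%N) (n %% m)%N.
have ZE i j : (j < m)%N -> Z (i * m + j)%N = nth 0 (LL i) j.
  by move=> jm; rewrite /Z divnMDl// divn_small// addn0 modnMDl modn_small.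
have LLP i z : (i < N)%N -> z \in LL i ->
    rnorm z <= 1 /\ (D (Y i) -> dl <= rnorm (z - Y i)).
  move=> iN /flattenP[s /nseqP[-> _]]; have [_ + _] := LP i iN; exact.
exists (m, Z); split=> //= [n nN|i iN].
  have nm : (n %/ m < N)%N by rewrite ltn_divLR.
  by have [] := LLP _ (Z n) nm; rewrite // mem_nth// LLs// ltn_mod.
split=> [|DY j jm]; last first.
  rewrite ZE//; have [|_ +] := LLP i (nth 0 (LL i) j) iN; last exact.
  by rewrite mem_nth// LLs.
have -> : block_average m (fun j => Z (i * m + j)%N) = average (LL i).
  rewrite -[in LHS](LLs i iN); apply: average_nth => j; rewrite LLs// => jm.
  exact: ZE.
have [L0 _ ?] := LP i iN.
rewrite average_repeat// divn_gt0// dvdn_leq//.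
by rewrite /m (bigD1 (Ordinal iN)) //= dvdn_mulr.
Qed.

(** An approximate martingale on the unit interval: level l is a step function
that takes the value Y l i on the i-th of N l equal intervals, each interval
is cut into m l equal parts at the next level, and every value in D jumps by
at least dl. The bounds on the averages telescope along the null sequence b. *)
Record tree (b : nat -> R) (N m : nat -> nat) (Y : nat -> nat -> X) : Prop := {
  tree_N0 : N 0%N = 1%N;
  tree_NS : forall l, N l.+1 = (N l * m l)%N;
  tree_m : forall l, (0 < m l)%N;
  tree_ball : forall l i, (i < N l)%N -> rnorm (Y l i) <= 1;
  tree_avg : forall l i, (i < N l)%N -> rnorm (block_average (m l)
    (fun j => Y l.+1 (i * m l + j)%N) - Y l i) <= b l - b l.+1;
  tree_far : forall l i j, (i < N l)%N -> (j < m l)%N -> D (Y l i) ->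
    dl <= rnorm (Y l.+1 (i * m l + j)%N - Y l i) }.

Lemma tree_exists (b : nat -> R) y0 : (forall l, b l.+1 < b l) ->
  rnorm y0 <= 1 ->
  exists N m Y, tree b N m Y /\ Y 0%N 0%N = y0.
Proof.
move=> bS y01.
have /choice[h hP] : forall s : nat * (nat * (nat -> X)),
  exists mZ : nat * (nat -> X),
    (forall i, (i < s.2.1)%N -> rnorm (s.2.2 i) <= 1) ->
  [/\ (0 < mZ.1)%N,
    forall i, (i < s.2.1 * mZ.1)%N -> rnorm (mZ.2 i) <= 1
  & forall i, (i < s.2.1)%N ->
      rnorm (block_average mZ.1 (fun j => mZ.2 (i * mZ.1 + j)%N) - s.2.2 i)
        <= b s.1 - b s.1.+1 /\
      (D (s.2.2 i) -> forall j, (j < mZ.1)%N ->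
        dl <= rnorm (mZ.2 (i * mZ.1 + j)%N - s.2.2 i))].
  move=> [l [N Y]] /=.
  have [Y1|Y1] := pselect (forall i, (i < N)%N -> rnorm (Y i) <= 1).
    have bl : 0 < b l - b l.+1 by rewrite subr_gt0.
    by have [mZ mZP] := refine_level bl Y1; exists mZ.
  by exists (0%N, fun=> 0) => /Y1.
pose fix st l : nat * (nat -> X) := if l is l'.+1 then
  ((st l').1 * (h (l', st l')).1, (h (l', st l')).2)%N else (1%N, fun=> y0).
have ball l i : (i < (st l).1)%N -> rnorm ((st l).2 i) <= 1.
  elim: l i => [|l IH] i; first by [].
  by have [_ + _] := hP (l, st l) IH; exact.
exists (fun l => (st l).1), (fun l => (h (l, st l)).1), (fun l => (st l).2).
split=> //.
split=> // [l|l i iN|l i j iN jm DY].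
- by have [] := hP (l, st l) (ball l).
- by have [_ _ /(_ i iN)[]] := hP (l, st l) (ball l).
- by have [_ _ /(_ i iN)[_ /(_ DY)]] := hP (l, st l) (ball l); exact.
Qed.

End tree.

Section limits.
Context (R : realType) (k : scalar_kind).
Local Notation K := (scalar_field R k).
Context (X : normedModType K).
Implicit Types (u : nat -> X) (x a : X).

Lemma cvg_rnormP u x : u @ \oo --> x <->
  forall e : R, 0 < e -> exists n0, forall n, (n0 <= n)%N -> rnorm (x - u n) < e.
Proof.
split=> [/cvgrPdist_lt ux e e0|ux].
  have eK : 0 < ofR k e.
    by rewrite lt_neqAle -(ofR0 R k) ler_ofR ltW// andbT; apply/eqP => /(congr1 re);
       rewrite !ofRK => /eqP; rewrite lt_eqF.
  have [n0 _ n0P] := ux _ eK; exists n0 => n /n0P /=.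
  rewrite -ofR_norm lt_neqAle ler_ofR lt_neqAle => /andP[ne ->]; rewrite andbT.
  by apply: contra ne => /eqP ->.
apply/cvgrPdist_lt => e e0.
have eE : e = ofR k (rnorm e) by rewrite ofR_norm gtr0_norm.
have [n0 n0P] := ux (rnorm e) ltac:(by rewrite rnorm_gt0 gt_eqF).
exists n0 => // n /= /n0P xn; rewrite -ofR_norm eE lt_neqAle ler_ofR ltW// andbT.
by apply/eqP => /(congr1 re); rewrite !ofRK => /eqP; rewrite lt_eqF.
Qed.

Lemma rnorm_cvg_le u x a (c : R) n0 : u @ \oo --> x ->
  (forall n, (n0 <= n)%N -> rnorm (u n - a) <= c) -> rnorm (x - a) <= c.
Proof.
move=> /cvg_rnormP ux uc; apply/ler_addgt0Pr => e /ux[n1 n1P].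
have := n1P (maxn n0 n1) (leq_maxr _ _); have := uc _ (leq_maxl n0 n1).
have := rnormB_tri x (u (maxn n0 n1)) a; lra.
Qed.

End limits.

Lemma cauchy_rnorm_cvg (R : realType) (k : scalar_kind)
    (X : completeNormedModType (scalar_field R k)) (u : nat -> X) :
  (forall e : R, 0 < e -> exists l, forall n, rnorm (u (l + n)%N - u l) <= e) ->
  exists x : X, u @ \oo --> x.
Proof.
move=> uC; have /cauchy_cvgP/cvg_ex[x ux] : cauchy (u @ \oo).
  apply: cauchy_exP => e e0.
  have eE : e = ofR k (rnorm e) by rewrite ofR_norm gtr0_norm.
  have r0 : 0 < rnorm e by rewrite rnorm_gt0 gt_eqF.
  have [l lP] := uC (rnorm e / 2) ltac:(by rewrite divr_gt0).
  exists (u l), l => // n /= ln; rewrite -ball_normE /=.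
  rewrite -ofR_norm eE -(subnKC ln) lt_neqAle ler_ofR.
  have := lP (n - l)%N; rewrite rnormBC => h.
  have {}h : rnorm (u l - u (l + (n - l))%N) < rnorm e by lra.
  rewrite ltW// andbT.
  by apply/eqP => /(congr1 re); rewrite !ofRK => /eqP; rewrite lt_eqF.
by exists x.
Qed.

Section tree_descend.
Context (R : realType) (k : scalar_kind).
Local Notation K := (scalar_field R k).
Context (X : normedModType K).
Variables (D : set X) (dl : R) (b : nat -> R) (N m : nat -> nat).
Variable (Y : nat -> nat -> X).
Hypothesis tY : tree D dl b N m Y.

Lemma tree_N_gt0 l : (0 < N l)%N.
Proof.
elim: l => [|l IH]; first by rewrite (tree_N0 tY).
by rewrite (tree_NS tY) muln_gt0 IH (tree_m tY).
Qed.

(** The errors of the successive averages add up to at most b l. *)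
Lemma tree_descend l n : exists M, [/\ (0 < M)%N, N (l + n)%N = (N l * M)%N &
  forall i, (i < N l)%N ->
    rnorm (block_average M (fun j => Y (l + n)%N (i * M + j)%N) - Y l i)
      <= b l - b (l + n)%N].
Proof.
elim: n => [|n [M [M0 NM IH]]].
  exists 1%N; split; rewrite ?addn0 ?muln1// => i iN.
  rewrite /block_average big_ord1 invr1 ofR1 scale1r addn0 muln1 !subrr.
  by rewrite rnorm0.
set Q := m (l + n)%N; have Q0 : (0 < Q)%N := tree_m tY (l + n)%N.
exists (M * Q)%N; split=> [||i iN].
- by rewrite muln_gt0 M0.
- by rewrite addnS (tree_NS tY) NM mulnA.
have M0R : M%:R != 0 :> R by rewrite pnatr_eq0 -lt0n.
have -> : block_average (M * Q) (fun j => Y (l + n.+1)%N (i * (M * Q) + j)%N) - Y l i =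
    ofR k M%:R^-1 *: \sum_(j < M) (block_average Q
      (fun j' => Y (l + n).+1 ((i * M + j) * Q + j')%N) - Y (l + n)%N (i * M + j)%N)
    + (block_average M (fun j => Y (l + n)%N (i * M + j)%N) - Y l i).
  rewrite sumrB scalerBr addrA subrK; congr (_ - _).
  rewrite /block_average -scaler_sumr scalerA -ofRM -invfM -natrM; congr (_ *: _).
  rewrite (sum_blocks M Q (fun j => Y (l + n.+1)%N (i * (M * Q) + j)%N)).
  apply: eq_bigr => j _; apply: eq_bigr => j' _.
  by rewrite addnS mulnDl addnA mulnA.
rewrite (le_trans (rnormD _ _))//.
have -> : b l - b (l + n.+1)%N =
    (b (l + n)%N - b (l + n).+1) + (b l - b (l + n)%N) by rewrite addnS; ring.
rewrite lerD ?IH// rnormZr ger0_norm ?invr_ge0//.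
rewrite mulrC ler_pdivrMr ?ltr0n//.
rewrite (le_trans (rnorm_sum _ _ _))// mulr_natr -[X in _ *+ X](card_ord M).
rewrite -sumr_const; apply: ler_sum => j _; apply: (tree_avg tY).
by rewrite NM -ltn_divLR// divnMDl// divn_small// addn0.
Qed.

End tree_descend.

(** * Vector measures dominated by a finite measure *)

Section real_mass.
Context (R : realType) d (Omega : measurableType d).
Variable mu : {finite_measure set Omega -> \bar R}.
Implicit Types A B E : set Omega.

Definition mass A : R := fine (mu A).

Lemma massK A : measurable A -> (mass A)%:E = mu A.
Proof. by move=> mA; rewrite fineK// fin_num_measure. Qed.

Lemma mass_ge0 A : 0 <= mass A.
Proof. exact/fine_ge0/measure_ge0. Qed.

Lemma mass0 : mass set0 = 0.
Proof. by rewrite /mass measure0. Qed.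

Lemma massU A B : measurable A -> measurable B -> A `&` B = set0 ->
  mass (A `|` B) = mass A + mass B.
Proof.
move=> mA mB AB; apply: EFin_inj; rewrite EFinD !massK//; last exact: measurableU.
exact: measureU.
Qed.

Lemma le_mass A B : measurable A -> measurable B -> A `<=` B -> mass A <= mass B.
Proof. by move=> mA mB AB; rewrite -lee_fin !massK// le_measure// inE. Qed.

Lemma mass_bigU (A : nat -> set Omega) n : (forall i, measurable (A i)) ->
  (forall i j, (i < n)%N -> (j < n)%N -> i != j -> A i `&` A j = set0) ->
  mass (\big[setU/set0]_(i < n) A i) = \sum_(i < n) mass (A i).
Proof.
move=> mA; elim: n => [|n IH] dA; first by rewrite !big_ord0 mass0.
rewrite !big_ord_recr /= massU ?IH//; last 2 first.
- exact: bigsetU_measurable.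
- rewrite big_distrl /= big1// => i _; apply: dA => //.
    by rewrite ltnS ltnW.
  by rewrite ltn_eqF.
by move=> i j iN jN; apply: dA; rewrite ltnS ltnW.
Qed.

Section dominated.
Context (k : scalar_kind) (X : normedModType (scalar_field R k)).
Variable F : set Omega -> X.
Hypothesis F_le : forall E, measurable E -> rnorm (F E) <= mass E.
Hypothesis F_add : forall A B, measurable A -> measurable B ->
  A `&` B = set0 -> F (A `|` B) = F A + F B.

Lemma dominated_set0 : F set0 = 0.
Proof.
apply: rnorm_eq0; apply/eqP; rewrite eq_le rnorm_ge0 andbT -mass0; exact: F_le.
Qed.

Lemma dominated_bigU (A : nat -> set Omega) n : (forall i, measurable (A i)) ->
  (forall i j, (i < n)%N -> (j < n)%N -> i != j -> A i `&` A j = set0) ->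
  F (\big[setU/set0]_(i < n) A i) = \sum_(i < n) F (A i).
Proof.
move=> mA; elim: n => [|n IH] dA; first by rewrite !big_ord0 dominated_set0.
rewrite !big_ord_recr /= F_add ?IH//; last 2 first.
- exact: bigsetU_measurable.
- rewrite big_distrl /= big1// => i _; apply: dA => //.
    by rewrite ltnS ltnW.
  by rewrite ltn_eqF.
by move=> i j iN jN; apply: dA; rewrite ltnS ltnW.
Qed.

(** Countable additivity is inherited from mu, as the tail of the series is
the value of F on a set of small measure. *)
Lemma dominated_vector_measure : vector_measure F.
Proof.
move=> A mA tA; have dA i j : i != j -> A i `&` A j = set0.
  by move=> ij; move/trivIsetP : tA; exact.
have mU : measurable (\bigcup_n A n) by exact: bigcup_measurable.
have : (\sum_(0 <= i < n) mu (A i))%E @[n --> \oo] --> mu (\bigcup_n A n).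
  exact: measure_sigma_additive.
rewrite -(massK mU) => /fine_cvgP[_ cA]; apply/cvg_rnormP => e e0.
move/cvgrPdist_lt : cA => /(_ e e0)[n0 _ n0P].
exists n0 => n /n0P /=; apply: le_lt_trans.
have -> : fine (\sum_(0 <= i < n) mu (A i))%E = mass (\big[setU/set0]_(i < n) A i).
  rewrite mass_bigU// => [|i j _ _]; last exact: dA.
  rewrite big_mkord (eq_bigr (fun i : 'I_n => (mass (A i))%:E)) ?sumEFin// => i _.
  by rewrite massK.
set V := \big[setU/set0]_(i < n) A i.
have mV : measurable V by exact: bigsetU_measurable.
have VU : V `<=` \bigcup_n A n by rewrite /V -bigcup_mkord => w [i _ Aw]; exists i.
have UE : \bigcup_n A n = V `|` (\bigcup_n A n `\` V) by rewrite setDUK.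
have mD : measurable (\bigcup_n A n `\` V) by exact: measurableD.
have VD : V `&` (\bigcup_n A n `\` V) = set0 by rewrite setDIK.
have -> : series (fun n => F (A n)) n = F V.
  by rewrite /series /= big_mkord dominated_bigU// => i j _ _; exact: dA.
rewrite UE F_add// massU// [F V + _]addrC [mass V + _]addrC !addrK.
by rewrite (le_trans (F_le mD))// ler_norm.
Qed.

Lemma dominated_bounded_variation : Defs.bounded_variation F.
Proof.
exists (mass [set: Omega]) => n A mA tA.
rewrite (@le_trans _ _ (\sum_(i < n) mass (A i)))//.
  by apply: ler_sum => i _; exact: F_le.
rewrite -mass_bigU// => [|i j iN jN ij]; last by move/trivIsetP : tA; exact.
by apply: le_mass => //; exact: bigsetU_measurable.
Qed.

Lemma dominated_mu_continuous : mu_continuous mu F.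
Proof.
move=> e e0; exists e => // E mE; rewrite -massK// lte_fin.
exact: le_lt_trans (F_le mE).
Qed.

End dominated.

End real_mass.

Section tree_measure.
Context (R : realType) (k : scalar_kind).
Local Notation K := (scalar_field R k).
Context d (Omega : measurableType d).
Variable mu : {finite_measure set Omega -> \bar R}.
Variable cell : nat -> nat -> set Omega.
Hypothesis mcell : forall N i, measurable (cell N i).
Hypothesis cell_disjoint : forall N i j, i != j -> cell N i `&` cell N j = set0.
Hypothesis cell_mass : forall N i, (i < N)%N -> mass mu (cell N i) = N%:R^-1.
Hypothesis cell_refine : forall N M i, (0 < N)%N -> (0 < M)%N ->
  cell N i = \big[setU/set0]_(j < M) cell (N * M) (i * M + j)%N.
Implicit Types E : set Omega.

Definition weight E N i : R := mass mu (E `&` cell N i).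

Lemma weight_ge0 E N i : 0 <= weight E N i.
Proof. exact: mass_ge0. Qed.

Lemma weight_le E N i : measurable E -> (i < N)%N -> weight E N i <= N%:R^-1.
Proof.
by move=> mE iN; rewrite -(cell_mass iN); apply: le_mass => //; exact: measurableI.
Qed.

Lemma weightU E E' N i : measurable E -> measurable E' -> E `&` E' = set0 ->
  weight (E `|` E') N i = weight E N i + weight E' N i.
Proof.
move=> mE mE' EE; rewrite /weight setIUl massU//; try exact: measurableI.
by rewrite setIACA EE set0I.
Qed.

Lemma weight_refine E N M i : measurable E -> (0 < N)%N -> (0 < M)%N ->
  weight E N i = \sum_(j < M) weight E (N * M) (i * M + j)%N.
Proof.
move=> mE N0 M0; rewrite /weight (cell_refine _ N0 M0) big_distrr /=.
rewrite -(@mass_bigU _ _ _ mu (fun j => E `&` cell (N * M) (i * M + j)%N))//.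
  by move=> j; exact: measurableI.
move=> j j' _ _ jj; rewrite setIACA cell_disjoint ?setI0//.
by rewrite eqn_add2l.
Qed.

Lemma weight_total E N : measurable E -> \sum_(i < N) weight E N i <= mass mu E.
Proof.
move=> mE; rewrite -(@mass_bigU _ _ _ mu (fun j => E `&` cell N j)).
- apply: le_mass => //; first by apply: bigsetU_measurable => i _; exact: measurableI.
  by rewrite -big_distrr /= ; exact: subIsetl.
- by move=> j; exact: measurableI.
- by move=> i j _ _ ij; rewrite setIACA cell_disjoint ?setI0.
Qed.

(** The energies of a set increase under refinement and stay below its mass,
hence converge. *)
Lemma weight_energy_le E N : measurable E -> energy N (weight E N) <= mass mu E.
Proof.
move=> mE; apply: le_trans (weight_total N mE).
rewrite /energy mulr_sumr; apply: ler_sum => i _.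
have N0 : 0 < N%:R :> R by rewrite ltr0n (leq_ltn_trans _ (ltn_ord i)).
rewrite expr2 mulrA ler_piMl ?weight_ge0// mulrC -ler_pdivlMr// mul1r.
exact: weight_le.
Qed.

Lemma weight_energy_mono E N M : measurable E -> (0 < N)%N -> (0 < M)%N ->
  energy N (weight E N) <= energy (N * M) (weight E (N * M)).
Proof.
move=> mE N0 M0; rewrite -subr_ge0 -(@energy_blocks _ N M _ _ M0); last first.
  by move=> i _; exact: weight_refine.
by rewrite mulr_ge0// sumr_ge0// => i _; rewrite sumr_ge0// => j _; rewrite sqr_ge0.
Qed.

End tree_measure.

(** * The limit measure of a tree *)

Section tree_limit.
Context (R : realType) (k : scalar_kind).
Local Notation K := (scalar_field R k).
Context d (Omega : measurableType d).
Variable mu : {finite_measure set Omega -> \bar R}.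
Variable cell : nat -> nat -> set Omega.
Hypothesis mcell : forall N i, measurable (cell N i).
Hypothesis cell_disjoint : forall N i j, i != j -> cell N i `&` cell N j = set0.
Hypothesis cell_mass : forall N i, (i < N)%N -> mass mu (cell N i) = N%:R^-1.
Hypothesis cell_refine : forall N M i, (0 < N)%N -> (0 < M)%N ->
  cell N i = \big[setU/set0]_(j < M) cell (N * M) (i * M + j)%N.
Context (X : completeNormedModType K).
Variables (D : set X) (dl : R) (b : nat -> R) (N m : nat -> nat).
Variable (Y : nat -> nat -> X).
Hypothesis tY : tree D dl b N m Y.
Hypothesis b_ge0 : forall l, 0 <= b l.
Hypothesis b_anti : forall l l', (l <= l')%N -> b l' <= b l.
Hypothesis b_lim : forall e : R, 0 < e -> exists l, b l <= e.
Implicit Types E : set Omega.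

Let w E l i : R := weight mu cell E (N l) i.
Let a E l : R := energy (N l) (w E l).
Let N0 l : (0 < N l)%N := tree_N_gt0 tY l.

(** How far the set E is from being spread evenly over the M parts of each of
the n cells. *)
Definition deviation (E : set Omega) (n M : nat) : R :=
  \sum_(i < n) \sum_(j < M)
    `|weight mu cell E (n * M) (i * M + j)%N - weight mu cell E n i / M%:R|.

Lemma deviation_energy E n M (s : R) : measurable E -> (0 < n)%N -> (0 < M)%N ->
  0 < s -> deviation E n M <= s / 2 + (energy (n * M) (weight mu cell E (n * M)) -
    energy n (weight mu cell E n)) / (2 * s).
Proof.
by move=> mE n0 M0 s0; apply: deviation_le => // i _; exact: weight_refine.
Qed.

Lemma energy_tail E (s : R) : measurable E -> 0 < s ->
  exists l0, forall l n, (l0 <= l)%N -> a E (l + n)%N - a E l <= s.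
Proof.
move=> mE s0; have a_mono l n : a E l <= a E (l + n)%N.
  have [M [M0 NM _]] := tree_descend tY l n.
  by rewrite /a /w NM; exact: weight_energy_mono.
have a_le l : a E l <= mass mu E by exact: weight_energy_le.
have hs : has_sup (range (a E)).
  by split; [exists (a E 0%N), 0%N|exists (mass mu E) => _ [l _ <-]].
have [_ [l0 _ <-] al0] := sup_adherent s0 hs.
exists l0 => l n l0l; have := a_mono l0 (l - l0)%N; rewrite subnKC//.
have := sup_upper_bound hs (ex_intro2 _ _ (l + n)%N I erefl); rewrite -/(a E _); lra.
Qed.

(** The integral over E of the step function at level l. *)
Definition partial E l : X := \sum_(i < N l) ofR k (weight mu cell E (N l) i) *: Y l i.

Lemma partial_norm E l : measurable E -> rnorm (partial E l) <= mass mu E.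
Proof.
move=> mE; apply: le_trans (weight_total mu mcell cell_disjoint (N l) mE).
rewrite (le_trans (rnorm_sum _ _ _))//; apply: ler_sum => i _.
rewrite rnormZr ger0_norm ?weight_ge0// ler_piMr ?weight_ge0//.
exact: (tree_ball tY).
Qed.

Lemma partialU E E' l : measurable E -> measurable E' -> E `&` E' = set0 ->
  partial (E `|` E') l = partial E l + partial E' l.
Proof.
move=> mE mE' EE; rewrite /partial -big_split /=; apply: eq_bigr => i _.
by rewrite weightU// ofRD scalerDl.
Qed.

(** If E were spread evenly over the parts of each cell, the two integrals
would differ only by the errors of the averages. *)
Lemma partial_diff E l n : measurable E -> exists M,
  [/\ (0 < M)%N, N (l + n)%N = (N l * M)%N &
   rnorm (partial E (l + n)%N - partial E l) <=
     deviation E (N l) M + b l * mass mu E].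
Proof.
move=> mE; have [M [M0 NM Yavg]] := tree_descend tY l n.
exists M; split=> //.
have M0R : M%:R != 0 :> R by rewrite pnatr_eq0 -lt0n.
pose v i j := weight mu cell E (N l * M) (i * M + j)%N - weight mu cell E (N l) i / M%:R.
have -> : partial E (l + n)%N - partial E l =
    \sum_(i < N l) (\sum_(j < M) ofR k (v i j) *: Y (l + n)%N (i * M + j)%N +
      ofR k (weight mu cell E (N l) i) *:
        (block_average M (fun j => Y (l + n)%N (i * M + j)%N) - Y l i)).
  rewrite /partial NM (sum_blocks (N l) M
    (fun i => ofR k (weight mu cell E (N l * M) i) *: Y (l + n)%N i)).
  rewrite -sumrB; apply: eq_bigr => i _.
  rewrite scalerBr addrA; congr (_ - _).
  rewrite /block_average scalerA -ofRM scaler_sumr -big_split /=.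
  apply: eq_bigr => j _; rewrite -scalerDl -ofRD /v.
  by rewrite subrK.
rewrite (le_trans (rnorm_sum _ _ _))//.
apply: (@le_trans _ _ (\sum_(i < N l)
  (\sum_(j < M) `|v i j| + b l * weight mu cell E (N l) i))).
  apply: ler_sum => i _; rewrite (le_trans (rnormD _ _))// lerD//.
    rewrite (le_trans (rnorm_sum _ _ _))//; apply: ler_sum => j _.
    rewrite rnormZr ler_piMr//; apply: (tree_ball tY).
    by rewrite NM -ltn_divLR// divnMDl// divn_small// addn0.
  rewrite rnormZr ger0_norm ?weight_ge0// mulrC ler_wpM2r ?weight_ge0//.
  by rewrite (le_trans (Yavg _ _))// gerBl.
rewrite big_split /= -mulr_sumr lerD2l ler_wpM2l//.
exact: weight_total.
Qed.

(** The energies of E converge, so deviation_le makes the deviations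
between late levels small. *)
Lemma partial_cvg E : measurable E -> exists v : X, partial E @ \oo --> v.
Proof.
move=> mE; apply: cauchy_rnorm_cvg => e e0.
have s0 : 0 < e / 2 by rewrite divr_gt0.
have [l0 tail] := energy_tail mE (exprn_gt0 2 s0).
have m0 : 0 < mass mu E + 1 by rewrite ltr_wpDl// mass_ge0.
have [l1 bl1] := b_lim (divr_gt0 s0 m0).
exists (maxn l0 l1) => n; set l := maxn l0 l1.
have [M [M0 NM /le_trans]] := partial_diff l n mE; apply.
have := deviation_energy mE (N0 l) M0 s0.
have := tail l n (leq_maxl _ _); rewrite /a /w NM => ta.
have bl : b l * mass mu E <= e / 2.
  have blb : b l <= e / 2 / (mass mu E + 1).
    by rewrite (le_trans _ bl1)// b_anti// leq_maxr.
  rewrite (le_trans (ler_wpM2r (mass_ge0 _ _) blb))// mulrAC ler_pdivrMr//.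
  by rewrite ler_wpM2l ?(ltW s0)// lerDl.
move: (_ - _) ta => q /(half_square s0); lra.
Qed.

(** A cell is spread evenly over its own parts, so its deviation is zero. *)
Lemma partial_cell l n i : (i < N l)%N ->
  rnorm (partial (cell (N l) i) (l + n)%N - ofR k (N l)%:R^-1 *: Y l i)
    <= b l / (N l)%:R.
Proof.
move=> iN; have wE j : weight mu cell (cell (N l) i) (N l) j =
    if j == i then (N l)%:R^-1 else 0.
  rewrite /weight; case: eqVneq => [->|ji]; first by rewrite setIid cell_mass.
  by rewrite cell_disjoint ?mass0// eq_sym.
have <- : partial (cell (N l) i) l = ofR k (N l)%:R^-1 *: Y l i.
  rewrite /partial (bigD1 (Ordinal iN)) //= wE// eqxx big1 ?addr0// => j ji.
  rewrite wE//; case: eqP => [jE|_]; last by rewrite ofR0 scale0r.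
  by case/eqP : ji; exact: val_inj.
have [M [M0 NM /le_trans]] := partial_diff l n (mcell (N l) i); apply.
rewrite cell_mass// [X in X + _](_ : _ = 0) ?add0r//.
rewrite /deviation big1// => j _; rewrite big1// => j' _.
apply/eqP; rewrite normr_eq0 subr_eq0; apply/eqP.
have sub i' : cell (N l * M) (i' * M + j')%N `<=` cell (N l) i'.
  rewrite [X in _ `<=` X](cell_refine _ (N0 l) M0) => x xc.
  by rewrite -(bigcup_mkord M (fun j => cell (N l * M) (i' * M + j)%N)); exists j' => //=.
rewrite wE// /weight; case: eqP => [->|ji].
  rewrite setIC (setIidl (@sub _)) cell_mass ?natrM ?invfM//.
  by rewrite -ltn_divLR// divnMDl// divn_small// addn0.
rewrite mul0r (_ : _ `&` _ = set0) ?mass0//.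
rewrite -subset0 => x [xi /sub xj].
by rewrite -(@cell_disjoint (N l) i j)//; apply/eqP => /esym.
Qed.

(** The martingale converges as a vector measure, even though its values need
not converge. This is where completeness enters. *)
Lemma tree_limit_measure : exists F : set Omega -> X,
  [/\ forall E, measurable E -> rnorm (F E) <= mass mu E,
      forall E E', measurable E -> measurable E' -> E `&` E' = set0 ->
        F (E `|` E') = F E + F E'
    & forall l i, (i < N l)%N ->
        rnorm (F (cell (N l) i) - ofR k (N l)%:R^-1 *: Y l i) <= b l / (N l)%:R].
Proof.
have /choice[F FP] : forall E, exists v : X, measurable E -> partial E @ \oo --> v.
  move=> E; have [mE|mE] := pselect (measurable E); last by exists 0.
  by have [v pv] := partial_cvg mE; exists v.
exists F; split=> [E mE|E E' mE mE' EE|l i iN].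
- rewrite -[F E]subr0; apply: (@rnorm_cvg_le _ _ _ _ _ _ _ 0 (FP _ mE)) => l _.
  by rewrite subr0; exact: partial_norm.
- have FU := FP _ (measurableU _ _ mE mE').
  have FD : partial (E `|` E') @ \oo --> F E + F E'.
    rewrite (_ : partial (E `|` E') = partial E + partial E').
      by apply: cvgD; exact: FP.
    by apply/funext => l; rewrite partialU.
  exact: (cvg_unique (@norm_hausdorff _ _) FU FD).
- apply: (@rnorm_cvg_le _ _ _ _ _ _ _ l (FP _ (mcell _ _))) => n ln.
  by rewrite -(subnKC ln); exact: partial_cell.
Qed.

End tree_limit.

(** * Estimates for the Bochner integral *)

Section Bochner_estimates.
Context (R : realType) (k : scalar_kind).
Local Notation K := (scalar_field R k).
Context d (Omega : measurableType d) (X : normedModType K).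
Variable mu : {finite_measure set Omega -> \bar R}.
Implicit Types (s t : Omega -> X) (E : set Omega).

Lemma measurable_simple2 d' (U : measurableType d') (h : X -> X -> U) s t :
  simple_fun s -> simple_fun t ->
  measurable_fun [set: Omega] (fun w => h (s w) (t w)).
Proof.
move=> [fs ms] [ft mt] _ B mB; rewrite setTI.
have -> : (fun w => h (s w) (t w)) @^-1` B = \bigcup_(z in
    (range s `*` range t) `&` [set z | B (h z.1 z.2)])
    (s @^-1` [set z.1] `&` t @^-1` [set z.2]).
  apply/seteqP; split => [w Bw|w [[x y] /= [_ Bxy] [-> ->]]]//.
  by exists (s w, t w) => //; split=> //; split; exists w.
apply: fin_bigcup_measurable => [|z _]; last exact: measurableI.
by apply: finite_setIl; exact: finite_setX.
Qed.

Lemma simple_fun_sumE (h : X -> R) s w : simple_fun s ->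
  h (s w) = \sum_(x <- fset_set (range s)) h x * \1_(s @^-1` [set x]) w.
Proof.
move=> [fs ms]; rewrite (bigD1_seq (s w)) ?fset_uniq//=; last first.
  by rewrite in_fset_set// inE; exists w.
rewrite indicE mem_set//= mulr1 big1 ?addr0// => x xw.
by rewrite indicE memNset ?mulr0//= => wx; case/eqP : xw.
Qed.

Lemma integral_simple (h : X -> R) s E : simple_fun s -> measurable E ->
  mu.-integrable E (EFin \o (h \o s)) /\
  (\int[mu]_(w in E) (h (s w))%:E)%E =
    (\sum_(x <- fset_set (range s)) h x * mass mu (E `&` s @^-1` [set x]))%:E.
Proof.
move=> ss mE; have [fs ms] := ss.
have int1 x : mu.-integrable E (fun w => (\1_(s @^-1` [set x]) w)%:E).
  apply: (@integrableS _ _ _ mu [set: Omega]) => //.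
  exact: integrable_indic.
have int x : mu.-integrable E (fun w => ((h x)%:E * (\1_(s @^-1` [set x]) w)%:E)%E).
  exact: integrableZl.
have hE w : (h (s w))%:E = (\sum_(x <- fset_set (range s))
    (h x)%:E * (\1_(s @^-1` [set x]) w)%:E)%E.
  by rewrite simple_fun_sumE// -sumEFin; apply: eq_bigr => x _; rewrite EFinM.
split.
  rewrite (_ : EFin \o _ = (fun w => \sum_(x <- fset_set (range s))
    (h x)%:E * (\1_(s @^-1` [set x]) w)%:E)%E); last exact/funext.
  exact: integrable_sum.
under eq_integral do rewrite hE.
rewrite integral_sum// -sumEFin; apply: eq_bigr => x _.
rewrite integralZl// integral_indic// EFinM massK; last exact: measurableI.
by rewrite setIC.
Qed.

Lemma simple_integralE E s : simple_fun s -> simple_integral mu E s =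
  \sum_(x <- fset_set (range s)) ofR k (mass mu (E `&` s @^-1` [set x])) *: x.
Proof. by move=> [fs ms]; rewrite /simple_integral fsbig_finite. Qed.

(** Applying a functional that norms the difference reduces the estimate to
real-valued integrals. *)
Lemma simple_integral_dist E s t : simple_fun s -> simple_fun t -> measurable E ->
  ((rnorm (simple_integral mu E s - simple_integral mu E t))%:E <=
  \int[mu]_(w in E) (rnorm (s w - t w))%:E)%E.
Proof.
move=> ss st mE; set v := _ - _.
have [->|v0] := eqVneq v 0.
  by rewrite rnorm0; apply: integral_ge0 => w _; rewrite lee_fin rnorm_ge0.
have [f [cf fv fn]] := norming_functional (rnorm_normalize v0).
have fvE : re (f v : K) = rnorm v.
  have vn : rnorm v != 0 by rewrite gt_eqF// rnorm_gt0.
  have := functionalZ f (ofR k (rnorm v)^-1) v; rewrite fv => /(congr1 re).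
  rewrite re_ofRM -(ofR1 R k) ofRK => fvE.
  by apply: (mulfI (invr_neq0 vn)); rewrite -fvE mulVf.
pose h x := re (f x : K).
have hD x y : h (x - y) = h x - h y.
  by rewrite /h raddfB /= reD reN.
have hs u : simple_fun u -> h (simple_integral mu E u) =
    \sum_(x <- fset_set (range u)) h x * mass mu (E `&` u @^-1` [set x]).
  move=> su; rewrite simple_integralE// /h raddf_sum /=.
  elim/big_rec2: _ => [|x y1 y2 _ <-]; first by rewrite re0.
  by rewrite reD functionalZ re_ofRM mulrC.
have [is_ IS] := integral_simple h ss mE.
have [it IT] := integral_simple h st mE.
have -> : (rnorm v)%:E = (\int[mu]_(w in E) (h (s w) - h (t w))%:E)%E.
  rewrite -fvE -/(h v) hD !hs// EFinB -IS -IT -integralB//.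
have mE2 (g : X -> X -> R) : measurable_fun E (fun w => g (s w) (t w)).
  by apply: measurable_funS (measurable_simple2 g ss st).
rewrite (le_trans (lee_abs _))// (le_trans (le_abse_integral _ mE _))//.
  by apply/measurable_EFinP; exact: (mE2 (fun x y => h x - h y)).
apply: ge0_le_integral => //.
- apply: measurableT_comp => //.
  by apply/measurable_EFinP; exact: (mE2 (fun x y => h x - h y)).
- by apply/measurable_EFinP; exact: (mE2 (fun x y => rnorm (x - y))).
- move=> w _; rewrite /= lee_fin -hD; move: (s w - t w) => x.
  rewrite ler_norml (le_trans (re_le_rnorm _) (fn _)) andbT lerNl -reN.
  by rewrite (le_trans (re_le_rnorm _))// rnormN.
Qed.

Lemma measurable_dist f s : strongly_measurable f -> simple_fun s ->
  measurable_fun [set: Omega] (fun w => rnorm (f w - s w)).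
Proof.
move=> [t st tf] ss.
apply: (@measurable_fun_cvg _ _ _ _ (fun n w => rnorm (t n w - s w))).
  by move=> n; exact: (measurable_simple2 (fun x y => rnorm (x - y)) (st n) ss).
move=> w _; apply/cvgrPdist_le => e e0; have /cvg_rnormP/(_ e e0)[n0 n0P] := tf w.
exists n0 => // n /= /n0P/ltW; apply: le_trans.
have := rnormB_tri (f w) (t n w) (s w); have := rnormB_tri (t n w) (f w) (s w).
by rewrite (rnormBC (t n w) (f w)) ler_norml => h1 h2; apply/andP; split; lra.
Qed.

Lemma L1_approx_lt f (t : nat -> Omega -> X) (e : R) : L1_approx mu f t -> 0 < e ->
  exists n0, forall n, (n0 <= n)%N ->
    (\int[mu]_w (rnorm (f w - t n w))%:E < e%:E)%E.
Proof.
move=> [_ /fine_cvgP[fint /cvgrPdist_lt cint]] e0.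
have [n0 _ n0P] : \forall n \near \oo, (\int[mu]_w (rnorm (f w - t n w))%:E < e%:E)%E.
  have {}cint := cint _ e0.
  near=> n; have fn : (\int[mu]_w (rnorm (f w - t n w))%:E)%E \is a fin_num by near: n.
  rewrite -(fineK fn) lte_fin (le_lt_trans (ler_norm _))//.
  by rewrite -normrN -sub0r; near: n.
by exists n0 => n /n0P.
Unshelve. all: by end_near. Qed.

Lemma Bochner_integral_dist E f v s : strongly_measurable f -> simple_fun s ->
  measurable E -> is_Bochner_integral mu E f v ->
  ((rnorm (v - simple_integral mu E s))%:E <=
   \int[mu]_(w in E) (rnorm (f w - s w))%:E)%E.
Proof.
move=> mf ss mE [t [st t0] tv].
apply/lee_addgt0Pr => e e0.
have e2 : 0 < e / 2 by rewrite divr_gt0.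
have /cvg_rnormP/(_ _ e2)[n0 n0P] := tv.
have [n1 n1P] := L1_approx_lt (conj st t0) e2.
pose n := maxn n0 n1.
have vn := n0P n (leq_maxl _ _); have fn := n1P n (leq_maxr _ _).
have mEr (g : Omega -> R) : measurable_fun [set: Omega] g ->
    measurable_fun E (fun w => (g w)%:E).
  by move=> mg; apply/measurable_EFinP; exact: measurable_funS mg.
apply: (@le_trans _ _ ((e / 2)%:E + \int[mu]_(w in E) (rnorm (t n w - s w))%:E)%E).
  apply: (@le_trans _ _ ((e / 2)%:E +
      (rnorm (simple_integral mu E (t n) - simple_integral mu E s))%:E)%E).
    rewrite -EFinD lee_fin (le_trans (rnormB_tri _ (simple_integral mu E (t n)) _))//.
    by rewrite lerD2r ltW.
  by rewrite leeD2l// simple_integral_dist.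
apply: (@le_trans _ _ ((e / 2)%:E + (\int[mu]_(w in E) (rnorm (f w - t n w))%:E +
    \int[mu]_(w in E) (rnorm (f w - s w))%:E))%E).
  rewrite leeD2l// -ge0_integralD//; first last.
  - by apply: mEr; exact: measurable_dist.
  - by move=> w _; rewrite lee_fin rnorm_ge0.
  - by apply: mEr; exact: measurable_dist.
  - by move=> w _; rewrite lee_fin rnorm_ge0.
  apply: ge0_le_integral => //.
  - by move=> w _; rewrite lee_fin rnorm_ge0.
  - by apply: mEr; exact: (measurable_simple2 (fun x y => rnorm (x - y))).
  - by apply: emeasurable_funD; apply: mEr; exact: measurable_dist.
  - move=> w _; rewrite -EFinD lee_fin (rnormBC (f w) (t n w)).
    exact: rnormB_tri.
rewrite addeA addeC leeD2l//.
rewrite [leRHS](_ : _ = ((e / 2)%:E + (e / 2)%:E)%E); last by rewrite -EFinD -splitr.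
rewrite leeD2l// ltW// (le_lt_trans _ fn)//.
apply: ge0_subset_integral => //.
  by apply/measurable_EFinP; exact: measurable_dist.
by move=> w _; rewrite lee_fin rnorm_ge0.
Qed.

(** A density is approximated in the mean by a simple function with the same
error on all partitions at once. *)
Lemma Bochner_partition_dist (A : nat -> set Omega) n (F : set Omega -> X) f s :
  strongly_measurable f -> simple_fun s -> (forall i, measurable (A i)) ->
  (forall i j, i != j -> A i `&` A j = set0) ->
  (forall E, measurable E -> is_Bochner_integral mu E f (F E)) ->
  ((\sum_(i < n) rnorm (F (A i) - simple_integral mu (A i) s))%:E <=
  \int[mu]_w (rnorm (f w - s w))%:E)%E.
Proof.
move=> mf ss mA dA Ff.
have tA : trivIset [set` iota 0 n] A by apply/trivIsetP => i j _ _; exact: dA.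
have mD := measurable_dist mf ss.
have pos w : (0 <= (rnorm (f w - s w))%:E)%E by rewrite lee_fin rnorm_ge0.
apply: (@le_trans _ _ (\sum_(i < n) \int[mu]_(w in A i) (rnorm (f w - s w))%:E)%E).
  rewrite -sumEFin; apply: lee_sum => i _.
  by apply: Bochner_integral_dist => //; exact: Ff.
rewrite -(big_mkord xpredT (fun i => \int[mu]_(w in A i) (rnorm (f w - s w))%:E)%E).
rewrite /index_iota subn0 -ge0_integral_bigsetU ?iota_uniq//; last first.
  by apply/measurable_EFinP; apply: measurable_funS mD.
apply: ge0_subset_integral => //; first exact: bigsetU_measurable.
exact/measurable_EFinP.
Qed.

End Bochner_estimates.

(** * Equal subintervals of the unit interval *)

Section equal_cells.
Context (R : realType).

Lemma lebesgue_unit_fin : (lebesgue_measure [set` `[0%R : R, 1%R]] < +oo)%E.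
Proof. by rewrite lebesgue_measure_itv/= lte_fin ltr01 -EFinB ltry. Qed.

Definition unit_lebesgue : {finite_measure set (measurableTypeR R) -> \bar R} :=
  @mfrestr _ (measurableTypeR R) R _ lebesgue_measure
    (measurable_itv `[0%R : R, 1%R]) lebesgue_unit_fin.

Definition equal_cell (N i : nat) : set (measurableTypeR R) :=
  [set` `[i%:R / N%:R, i.+1%:R / N%:R[].

Lemma measurable_equal_cell N i : measurable (equal_cell N i).
Proof. exact: measurable_itv. Qed.

Lemma equal_cellP N i x : (0 < N)%N ->
  equal_cell N i x <-> i%:R <= x * N%:R < i.+1%:R.
Proof.
by move=> N0; rewrite /equal_cell /= in_itv /= ler_pdivrMr ?ltr0n// ltr_pdivlMr ?ltr0n.
Qed.

Lemma equal_cell_disjoint N i j : i != j -> equal_cell N i `&` equal_cell N j = set0.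
Proof.
move=> ij; rewrite -subset0 => x [].
have [->|N0] := posnP N.
  rewrite /equal_cell /= !in_itv /= !invr0 !mulr0 => /andP[x0 /(le_lt_trans x0)].
  by rewrite ltxx.
move=> /equal_cellP-/(_ N0)/andP[ix xi] /equal_cellP-/(_ N0)/andP[jx xj].
have ij' : (i < j.+1)%N by rewrite -(ltr_nat R) (le_lt_trans ix xj).
have ji' : (j < i.+1)%N by rewrite -(ltr_nat R) (le_lt_trans jx xi).
by move/eqP : ij; apply; apply/eqP; rewrite eqn_leq -ltnS ij' -ltnS ji'.
Qed.

Lemma equal_cell_mass N i : (i < N)%N ->
  mass unit_lebesgue (equal_cell N i) = N%:R^-1.
Proof.
move=> iN; have N0 : 0 < N%:R :> R by rewrite ltr0n (leq_ltn_trans _ iN).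
rewrite /mass /unit_lebesgue /= /mfrestr /mrestr (setIidl _); last first.
  move=> x; rewrite /equal_cell /= !in_itv /= => /andP[ix xi].
  rewrite (le_trans _ ix) ?divr_ge0 ?(ltW N0)//= (le_trans (ltW xi))//.
  by rewrite ler_pdivrMr// mul1r ler_nat.
rewrite lebesgue_measure_itv /= lte_fin ltr_pM2r ?invr_gt0// ltr_nat ltnSn /=.
by rewrite -mulrBl -natrB// subSnn mul1r.
Qed.

Lemma equal_cell_refine N M i : (0 < N)%N -> (0 < M)%N ->
  equal_cell N i = \big[setU/set0]_(j < M) equal_cell (N * M) (i * M + j)%N.
Proof.
move=> N0 M0; rewrite -(bigcup_mkord M (fun j => equal_cell (N * M) (i * M + j)%N)).
have NM0 : (0 < N * M)%N by rewrite muln_gt0 N0.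
have MR : 0 < M%:R :> R by rewrite ltr0n.
apply/seteqP; split => [x /equal_cellP-/(_ N0)/andP[ix xi]|x [j /= jM]].
  have x0 : 0 <= x * N%:R * M%:R by rewrite mulr_ge0 ?(le_trans _ ix)// ltW.
  have /andP[tl tu] := truncn_itv x0; set t := Num.truncn _ in tl tu.
  have it : (i * M <= t)%N.
    rewrite -ltnS -(ltr_nat R) (le_lt_trans _ tu)// natrM ler_pM2r//.
  have ti : (t < i.+1 * M)%N.
    by rewrite -(ltr_nat R) (le_lt_trans tl)// natrM ltr_pM2r.
  exists (t - i * M)%N => /=; first by rewrite ltn_subLR// addnC -mulSn.
  by rewrite subnKC//; apply/equal_cellP => //; rewrite natrM mulrA tl.
move=> /equal_cellP-/(_ NM0)/andP[]; rewrite natrM mulrA => jx xj.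
apply/equal_cellP => //; rewrite -(ler_pM2r MR) -[X in _ && X](ltr_pM2r MR).
rewrite (le_trans _ jx) -?natrM ?ler_nat ?leq_addr//= (lt_le_trans xj)// ler_nat.
by rewrite mulSn [(M + _)%N]addnC -addnS leq_add2l.
Qed.

End equal_cells.

(** * The Radon-Nikodym property against persistent jumps *)

Section Radon_Nikodym_trees.
Context (R : realType) (k : scalar_kind).
Local Notation K := (scalar_field R k).
Context (X : completeNormedModType K).

Lemma eventually_sum_le (I : Type) (r : seq I) (u : I -> nat -> R) :
  (forall i (e : R), 0 < e -> exists l0, forall l, (l0 <= l)%N -> u i l <= e) ->
  forall e : R, 0 < e ->
  exists l0, forall l, (l0 <= l)%N -> \sum_(i <- r) u i l <= e.
Proof.
move=> ue; elim: r => [|i r IH] e e0.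
  by exists 0%N => l _; rewrite big_nil ltW.
have e2 : 0 < e / 2 by rewrite divr_gt0.
have [l1 l1P] := ue i _ e2; have [l2 l2P] := IH _ e2.
exists (maxn l1 l2) => l; rewrite geq_max => /andP[/l1P h1 /l2P h2].
by rewrite big_cons; lra.
Qed.

Section tree.
Variables (D : set X) (dl : R) (b : nat -> R) (N m : nat -> nat).
Variable (Y : nat -> nat -> X).
Hypothesis tY : tree D dl b N m Y.
Hypothesis b_ge0 : forall l, 0 <= b l.
Hypothesis b_anti : forall l l', (l <= l')%N -> b l' <= b l.
Hypothesis b_lim : forall e : R, 0 < e -> exists l, b l <= e.

Let mu := unit_lebesgue R.
Let cell := @equal_cell R.

Lemma deviation_small (E : set (measurableTypeR R)) (c : R) : measurable E ->
  0 <= c -> forall e : R, 0 < e -> exists l0, forall l, (l0 <= l)%N ->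
  c * deviation mu cell E (N l) (m l) <= e.
Proof.
move=> mE c0 e e0.
have c1 : 0 < c + 1 by rewrite ltr_wpDl.
have s0 : 0 < e / (c + 1) by rewrite divr_gt0.
have [l0 tail] := energy_tail (mu := mu) (@measurable_equal_cell R)
  (@equal_cell_disjoint R) (@equal_cell_mass R) (@equal_cell_refine R) tY mE
  (exprn_gt0 2 s0).
exists l0 => l l0l; have := tail l 1%N l0l; rewrite addn1 (tree_NS tY) => ta.
have := deviation_energy mu (@measurable_equal_cell R) (@equal_cell_disjoint R)
  (@equal_cell_refine R) mE (tree_N_gt0 tY l) (tree_m tY l) s0.
move: ta; set q := (_ - _); set s := e / (c + 1) in s0 * => qs dv.
have {}dv := le_trans dv (half_square s0 qs).
rewrite (le_trans (ler_wpM2l c0 dv))// /s mulrCA ler_piMr ?(ltW e0)//.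
by rewrite ler_pdivrMr// mul1r lerDl.
Qed.

(** Let f be a Radon-Nikodym density of the limit measure F and s a simple
function close to f in mean. The values at level l are close to the averages
of f, hence to those of s, over the cells. The averages of s over a cell and
over its parts differ by the deviations of the level sets of s, which tend
to zero. *)
Lemma increments_small (e : R) : Radon_Nikodym_property X -> 0 < e ->
  exists l, \sum_(i < N l) \sum_(j < m l)
    rnorm (Y l.+1 (i * m l + j)%N - Y l i) / (N l.+1)%:R <= e.
Proof.
move=> RNP e0.
have [F [F_le F_add F_cell]] := tree_limit_measure (mu := mu)
  (@measurable_equal_cell R) (@equal_cell_disjoint R) (@equal_cell_mass R)
  (@equal_cell_refine R) tY b_ge0 b_anti b_lim.
have [f [mf [t tf]] Ff] := RNP _ _ mu F (dominated_vector_measure F_le F_add)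
  (dominated_bounded_variation F_le) (dominated_mu_continuous F_le).
have e8 : 0 < e / 8 by rewrite divr_gt0.
have [n /(_ n (leqnn _)) hlt] := L1_approx_lt tf e8.
have ss : simple_fun (t n) := tf.1 n.
set s := t n in ss hlt.
have ms x : measurable (s @^-1` [set x]) by exact: ss.2.
pose r := fset_set (range s).
pose SI E := simple_integral mu E s.
have [l1 l1P] := @eventually_sum_le _ r
  (fun x l => rnorm x * deviation mu cell (s @^-1` [set x]) (N l) (m l))
  (fun x => deviation_small (ms x) (rnorm_ge0 x)) _ e8.
have [l2 l2P] := b_lim e8.
pose l := maxn l1 l2; exists l.
have {l1P} devl := l1P l (leq_maxl _ _).
have bl : b l <= e / 8 by rewrite (le_trans (b_anti (leq_maxr l1 l2))).
have bl1 : b l.+1 <= e / 8 by rewrite (le_trans (b_anti (leqnSn l))).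
have Nl := tree_N_gt0 tY l; have ml := tree_m tY l.
have NS := tree_NS tY l.
have N0R : (N l)%:R != 0 :> R by rewrite pnatr_eq0 -lt0n.
have m0R : (m l)%:R != 0 :> R by rewrite pnatr_eq0 -lt0n.
have part q : \sum_(i < q) rnorm (F (cell q i) - SI (cell q i)) <= e / 8.
  rewrite -lee_fin (le_trans _ (ltW hlt))//.
  apply: Bochner_partition_dist => //; first exact: measurable_equal_cell.
  exact: equal_cell_disjoint.
pose c i := cell (N l) i; pose c' i j := cell (N l * m l) (i * m l + j)%N.
pose w x i j := weight mu cell (s @^-1` [set x]) (N l * m l) (i * m l + j)%N -
   weight mu cell (s @^-1` [set x]) (N l) i / (m l)%:R.
have SIdiff i j : rnorm (SI (c' i j) - ofR k (m l)%:R^-1 *: SI (c i)) <=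
    \sum_(x <- r) rnorm x * `|w x i j|.
  rewrite /SI !simple_integralE// scaler_sumr -sumrB.
  rewrite (le_trans (rnorm_sum _ _ _))//; apply: ler_sum => x _.
  rewrite scalerA -ofRM -scalerBl -ofRN -ofRD rnormZr mulrC /w /weight.
  by rewrite !(setIC (s @^-1` _)) [_^-1 * _]mulrC.
(* Passage from the part to the cell along F and s on the part, then s and
   F on the cell. Each of the five errors sums to at most e / 8. *)
have main i j : (i < N l)%N -> (j < m l)%N ->
    rnorm (Y l.+1 (i * m l + j)%N - Y l i) / (N l.+1)%:R <=
    b l.+1 / (N l.+1)%:R + rnorm (F (c' i j) - SI (c' i j)) +
    \sum_(x <- r) rnorm x * `|w x i j| + rnorm (F (c i) - SI (c i)) / (m l)%:R +
    b l / (N l.+1)%:R.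
  move=> iN jm.
  have ijN : (i * m l + j < N l.+1)%N.
    by rewrite NS -ltn_divLR// divnMDl// divn_small// addn0.
  have cE : cell (N l.+1) (i * m l + j)%N = c' i j by rewrite /c' -NS.
  have H1 := F_cell l.+1 _ ijN; rewrite -/cell cE in H1.
  have H5 := F_cell l i iN; rewrite -/cell -/(c i) in H5.
  have P0 : 0 <= (N l.+1)%:R^-1 :> R by rewrite invr_ge0.
  have mi0 : 0 <= (m l)%:R^-1 :> R by rewrite invr_ge0.
  have NSE : (N l.+1)%:R^-1 = (m l)%:R^-1 * (N l)%:R^-1 :> R.
    by rewrite NS natrM invfM mulrC.
  set y' := Y l.+1 _ in H1 *; set y := Y l i in H5 *.
  pose q : K := ofR k (N l.+1)%:R^-1; rewrite -/q in H1.
  have -> : rnorm (y' - y) / (N l.+1)%:R = rnorm (q *: y' - q *: y).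
    by rewrite -scalerBr rnormZr ger0_norm// mulrC.
  have T1 := rnormB_tri (q *: y') (F (c' i j)) (q *: y).
  have T2 := rnormB_tri (F (c' i j)) (SI (c' i j)) (q *: y).
  have T3 := rnormB_tri (SI (c' i j)) (ofR k (m l)%:R^-1 *: SI (c i)) (q *: y).
  have T4 := rnormB_tri (ofR k (m l)%:R^-1 *: SI (c i))
    (ofR k (m l)%:R^-1 *: F (c i)) (q *: y).
  have E4 : rnorm (ofR k (m l)%:R^-1 *: SI (c i) - ofR k (m l)%:R^-1 *: F (c i)) =
      rnorm (F (c i) - SI (c i)) / (m l)%:R.
    by rewrite -scalerBr rnormZr ger0_norm// mulrC rnormBC.
  have E5 : rnorm (ofR k (m l)%:R^-1 *: F (c i) - q *: y) <= b l / (N l.+1)%:R.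
    rewrite /q NSE ofRM -scalerA -scalerBr rnormZr ger0_norm// mulrCA.
    by rewrite ler_wpM2l.
  rewrite rnormBC in H1.
  by have := SIdiff i j; lra.
apply: (@le_trans _ _ (\sum_(i < N l) \sum_(j < m l)
   (b l.+1 / (N l.+1)%:R + rnorm (F (c' i j) - SI (c' i j)) +
    \sum_(x <- r) rnorm x * `|w x i j| + rnorm (F (c i) - SI (c i)) / (m l)%:R +
    b l / (N l.+1)%:R))).
  by apply: ler_sum => i _; apply: ler_sum => j _; exact: main.
under eq_bigr do rewrite !big_split /=.
rewrite !big_split /=.
have cst z : \sum_(i < N l) \sum_(j < m l) z / (N l.+1)%:R = z :> R.
  rewrite -(sum_blocks (N l) (m l) (fun=> z / (N l.+1)%:R)) sumr_const card_ord -NS.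
  by rewrite -[LHS]mulr_natr divfK// NS natrM mulf_neq0.
rewrite !cst.
have h1 : \sum_(i < N l) \sum_(j < m l) rnorm (F (c' i j) - SI (c' i j)) <= e / 8.
  rewrite (le_trans _ (part (N l * m l)%N))//.
  by rewrite (sum_blocks (N l) (m l)
    (fun i => rnorm (F (cell (N l * m l) i) - SI (cell (N l * m l) i)))).
have h2 : \sum_(i < N l) \sum_(j < m l) rnorm (F (c i) - SI (c i)) / (m l)%:R <= e / 8.
  rewrite (le_trans _ (part (N l)))//; apply: ler_sum => i _.
  by rewrite sumr_const card_ord -[leLHS]mulr_natr divfK.
have h3 : \sum_(i < N l) \sum_(j < m l) \sum_(x <- r) rnorm x * `|w x i j| <= e / 8.
  rewrite (le_trans _ devl)//.
  under eq_bigr do rewrite exchange_big /=.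
  rewrite exchange_big /=; apply: ler_sum => x _.
  rewrite /deviation mulr_sumr; apply: ler_sum => i _.
  by rewrite mulr_sumr; apply: ler_sum => j _.
lra.
Qed.

End tree.

End Radon_Nikodym_trees.

Section Radon_Nikodym_Daugavet.
Context (R : realType) (k : scalar_kind).
Local Notation K := (scalar_field R k).
Context (X : completeNormedModType K) (G : groupType).
Variable rho : {multiplicative G -> Iso X}.

(** Otherwise every y of the ball with |T y| > 1 - e is an approximate average
of points at distance e / 2 from it, and there is a tree with these jumps
starting from a point y0 that almost norms T. On every level the mean of
|T y| is close to |T y0| and no value exceeds 1, so a fixed proportion of
the values jump: the mean increment does not tend to zero. *)
Lemma Radon_Nikodym_Daugavet_point (T : {linear X -> X}) (e : R) :
  Radon_Nikodym_property X -> G_Daugavet rho ->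
  continuous T -> opnorm T = 1 -> 0 < e ->
  exists y, [/\ rnorm y <= 1, 1 - e < rnorm (T y)
    & forall x, rnorm x = 1 -> exists g, 2 - e < rnorm (x + rho g y)].
Proof.
move=> RNP DP cT T1 e0; apply: contrapT => noy.
have Tn z : rnorm (T z) <= rnorm z by have := opnorm_bound z cT; rewrite T1 mul1r.
pose D := [set y : X | 1 - e < rnorm (T y)].
have splits y (e' : R) : rnorm y <= 1 -> D y -> 0 < e' ->
    exists L, [/\ (0 < size L)%N, forall z, z \in L -> far y (e / 2) z
      & rnorm (average L - y) <= e'].
  move=> y1 Dy e'0.
  have [x [x1 xg]] : exists x : X, rnorm x = 1 /\ forall g, rnorm (x + rho g y) <= 2 - e.
    apply: contrapT => nox; apply: noy; exists y; split=> // x x1.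
    apply: contrapT => nog; apply: nox; exists x; split=> // g.
    by rewrite leNgt; apply/negP => xg; apply: nog; exists g.
  exact: Daugavet_average DP y1 x1 e0 xg e'0.
have [y0 y01 Ty0] : exists2 y : X, rnorm y <= 1 & 1 - e / 4 < rnorm (T y).
  by apply: opnorm_gt_ex; rewrite T1; lra.
pose b l : R := e / 4 / 2 ^+ l.
have b_ge0 l : 0 <= b l by rewrite !divr_ge0// ltW.
have bS l : b l.+1 < b l.
  rewrite /b exprS invfM [2^-1 * _]mulrC mulrA ltr_pdivrMr//.
  by rewrite ltr_pMr ?ltr1n// !divr_gt0// exprn_gt0.
have b_anti l l' : (l <= l')%N -> b l' <= b l.
  by move=> ll; apply/(nonincreasing_seqP b).1 => // n; exact: ltW.
have b_lim (r : R) : 0 < r -> exists l, b l <= r.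
  move=> r0; exists (Num.truncn (e / 4 / r)).+1.
  set n := _.+1; have : e / 4 / r < 2 ^+ n.
    by rewrite (lt_le_trans (truncnS_gt _))// -natrX ler_nat ltnW// ltn_expl.
  by rewrite ltr_pdivrMr// => /ltW bn; rewrite /b ler_pdivrMr ?exprn_gt0// [leRHS]mulrC.
have [N [m [Y [tY Y0]]]] := tree_exists splits bS y01.
have e8 : 0 < e / 8 by rewrite divr_gt0.
have [l incr] := increments_small tY b_ge0 b_anti b_lim RNP e8.
have Nl := tree_N_gt0 tY l; have ml := tree_m tY l; have NS := tree_NS tY l.
have N0R : 0 < (N l)%:R :> R by rewrite ltr0n.
have m0R : 0 < (m l)%:R :> R by rewrite ltr0n.
(* y0 is within b 0 = e / 4 of the mean of the values at level l. *)
have avg : 1 - e / 2 <= \sum_(i < N l) rnorm (T (Y l i)) / (N l)%:R.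
  have [M [M0 NM /(_ 0%N)]] := tree_descend tY 0 l.
  rewrite add0n (tree_N0 tY) mul1n in NM *; subst M => /(_ isT).
  rewrite Y0.
  set A := block_average _ _ => Ay.
  have Ay0 : rnorm (A - y0) <= e / 4.
    by rewrite (le_trans Ay)// /b expr0 divr1 gerBl b_ge0.
  have : rnorm (T y0) - e / 4 <= rnorm (T A).
    have := rnormB_ge (T y0) (T A); have := Tn (y0 - A).
    by rewrite linearB /= (rnormBC y0 A); lra.
  have : rnorm (T A) <= \sum_(i < N l) rnorm (T (Y l i)) / (N l)%:R.
    rewrite /A /block_average operatorZ raddf_sum rnormZr ger0_norm ?invr_ge0//.
    rewrite mulrC -mulr_suml ler_wpM2r ?invr_ge0//.
    by rewrite (le_trans (rnorm_sum _ _ _)).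
  lra.
(* A value with |T y| > 1 - e moves by e / 2, which is at least half the
   excess of |T y| over 1 - e; for the others this excess is not positive. *)
have low : 2^-1 * (\sum_(i < N l) rnorm (T (Y l i)) / (N l)%:R - (1 - e)) <= e / 8.
  apply: le_trans incr.
  have -> : 1 - e = \sum_(i < N l) (1 - e) / (N l)%:R.
    by rewrite sumr_const card_ord -[RHS]mulr_natr divfK// gt_eqF.
  rewrite -sumrB mulr_sumr; apply: ler_sum => i _.
  rewrite -mulrBl mulrA.
  have -> : 2^-1 * (rnorm (T (Y l i)) - (1 - e)) / (N l)%:R =
      \sum_(j < m l) 2^-1 * (rnorm (T (Y l i)) - (1 - e)) / (N l.+1)%:R.
    rewrite sumr_const card_ord NS natrM -[RHS]mulr_natr; field.
    by rewrite !gt_eqF.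
  apply: ler_sum => j _.
  rewrite ler_pM2r ?invr_gt0 ?ltr0n; last exact: (tree_N_gt0 tY).
  have [DY|DY] := pselect (D (Y l i)).
    rewrite (le_trans _ (tree_far tY (ltn_ord i) (ltn_ord j) DY))//.
    have := Tn (Y l i); have := tree_ball tY (ltn_ord i); lra.
  rewrite (le_trans _ (rnorm_ge0 _))// pmulr_rle0// subr_le0 leNgt.
  exact/negP.
lra.
Qed.

Theorem Radon_Nikodym_Daugavet_index : (exists x : X, x != 0) ->
  Radon_Nikodym_property X -> G_Daugavet rho -> G_numerical_index rho = 1.
Proof.
move=> X0 RNP DP; apply: numerical_index_eq1 => // T cT T1.
apply: numerical_radius_eq1 => // e e0.
exact: Radon_Nikodym_Daugavet_point.
Qed.

End Radon_Nikodym_Daugavet.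

(** * Rearranging a positive density on the unit interval *)

Section monotone_rearrangement.
Context (R : realType).
Local Notation T := (measurableTypeR R).
Let mu := lebesgue01 R.
Implicit Types (s t : R) (A : set T).

Lemma lebesgue01E A : mu A = lebesgue_measure (A `&` [set` `[0 : R, 1]]).
Proof. by []. Qed.

Lemma lebesgue01_itvco_le s t : s <= t -> (mu [set` `[s, t[] <= (t - s)%:E)%E.
Proof.
move=> st; rewrite lebesgue01E.
apply: (@le_trans _ _ (lebesgue_measure [set` `[s, t[])).
  by apply: le_measure; rewrite ?inE//; exact: measurableI.
rewrite lebesgue_measure_itv /= lte_fin; case: ltP => // ts.
by rewrite lee_fin subr_ge0.
Qed.

Lemma lebesgue01_itvco s t : 0 <= s -> s <= t -> t <= 1 ->
  mu [set` `[s, t[] = (t - s)%:E.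
Proof.
move=> s0 st t1; rewrite lebesgue01E (setIidl _); last first.
  move=> x; rewrite /= !in_itv /= => /andP[sx xt].
  by rewrite (le_trans s0 sx) (le_trans (ltW xt) t1).
rewrite lebesgue_measure_itv /= lte_fin; case: ltP => // ts.
by rewrite (_ : t - s = 0)//; apply/eqP; rewrite subr_eq0 eq_le st ts.
Qed.

Lemma lebesgue01_rayN t : t <= 0 -> mu [set` `]-oo, t[] = 0%E.
Proof.
move=> t0; rewrite lebesgue01E (_ : _ `&` _ = set0) ?measure0//.
rewrite -subset0 => x [] /=; rewrite !in_itv /= => xt /andP[x0 _].
by move: (lt_le_trans xt (le_trans t0 x0)); rewrite ltxx.
Qed.

Lemma lebesgue01_tail : mu [set` `[1, +oo[] = 0%E.
Proof.
rewrite lebesgue01E; apply/eqP; rewrite -measure_le0 -(lebesgue_measure_set1 (1 : R)).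
apply: le_measure; rewrite ?inE//; first exact: measurableI.
move=> x [] /=; rewrite !in_itv /= andbT => x1 /andP[_ x1'].
by apply/eqP; rewrite eq_le x1 x1'.
Qed.

Lemma ray_splitU t u : t <= u ->
  [set` `]-oo, u[] = [set` `]-oo, t[] `|` [set` `[t, u[] :> set R.
Proof. by move=> tu; rewrite -itv_bndbnd_setU// bnd_simp. Qed.

Lemma ray_disjoint t u : [set` `]-oo, t[] `&` [set` `[t, u[] = set0 :> set R.
Proof.
rewrite -subset0 => x [] /=; rewrite !in_itv /= => xt /andP[tx _].
by move: (lt_le_trans xt tx); rewrite ltxx.
Qed.

Lemma lebesgue01_ray t : 0 <= t -> t <= 1 -> mu [set` `]-oo, t[] = t%:E.
Proof.
move=> t0 t1; rewrite (ray_splitU t0) measureU//; last exact: ray_disjoint.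
rewrite [X in (X + _)%E]lebesgue01_rayN// [X in (_ + X)%E]lebesgue01_itvco//.
by rewrite subr0 add0e.
Qed.

Lemma lebesgue01_ray1 t : 1 <= t -> mu [set` `]-oo, t[] = 1%E.
Proof.
move=> t1; rewrite (ray_splitU t1) measureU//; last exact: ray_disjoint.
rewrite [X in (X + _)%E]lebesgue01_ray// [X in (_ + X)%E](_ : _ = 0%E) ?adde0//.
apply/eqP; rewrite -measure_le0 -lebesgue01_tail.
apply: le_measure; rewrite ?inE// => x /=; rewrite !in_itv /= andbT.
by case/andP.
Qed.

Variable h : R -> R.
Hypothesis mh : measurable_fun [set: T] h.
Hypothesis h_gt0 : forall x, 0 < h x.
Hypothesis h1 : (\int[mu]_x (h x)%:E = 1)%E.

Definition density_mass A : \bar R := (\int[mu]_(x in A) (h x)%:E)%E.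
Local Notation nu := density_mass.

Let mhE A : measurable_fun A (EFin \o h).
Proof. by apply/measurable_EFinP; exact: measurable_funS mh. Qed.

Let h_ge0 x : (0 <= (h x)%:E)%E.
Proof. by rewrite lee_fin ltW. Qed.

Lemma density_mass_ge0 A : (0 <= nu A)%E.
Proof. exact: integral_ge0. Qed.

Lemma density_mass_le A B : measurable A -> measurable B -> A `<=` B ->
  (nu A <= nu B)%E.
Proof. by move=> mA mB AB; apply: ge0_subset_integral => //; exact: mhE. Qed.

Lemma density_mass_fin A : measurable A -> nu A \is a fin_num.
Proof.
move=> mA; rewrite ge0_fin_numE ?density_mass_ge0//.
apply: le_lt_trans (density_mass_le mA measurableT (@subsetT _ _)) _.
by rewrite /nu h1 ltry.
Qed.

Lemma density_massU A B : measurable A -> measurable B -> A `&` B = set0 ->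
  nu (A `|` B) = (nu A + nu B)%E.
Proof.
move=> mA mB AB; rewrite /density_mass ge0_integral_setU//.
exact/disj_set2P.
Qed.

Lemma density_mass_null A : measurable A -> mu A = 0%E -> nu A = 0%E.
Proof. by move=> mA A0; apply: null_set_integral => //; exact: mhE. Qed.

Lemma density_mass_gt0 A : measurable A -> (0 < mu A)%E -> (0 < nu A)%E.
Proof.
move=> mA muA; rewrite lt0e density_mass_ge0 andbT; apply/eqP => nuA.
have : (\int[mu]_(x in A) `|(EFin \o h) x|)%E = 0%E.
  by rewrite -[RHS]nuA; apply: eq_integral => x _; rewrite /= ger0_norm// ltW.
move/(ae_eq_integral_abs mu mA (mhE (A:=A))) => [N [mN N0 hN]].
move: muA; apply/negP; rewrite -leNgt -N0; apply: le_measure; rewrite ?inE// => x Ax.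
by apply: hN => /(_ Ax) [] /eqP; rewrite gt_eqF.
Qed.

Definition density_cdf t : R := fine (nu [set` `]-oo, t[]).
Local Notation phi := density_cdf.

Lemma density_cdfD s t : s <= t -> phi t = phi s + fine (nu [set` `[s, t[]).
Proof.
move=> st; rewrite /phi (ray_splitU st) density_massU//; last exact: ray_disjoint.
by rewrite fineD// density_mass_fin.
Qed.

Lemma density_cdf_mono s t : s <= t -> phi s <= phi t.
Proof.
by move=> st; rewrite (density_cdfD st) lerDl fine_ge0// density_mass_ge0.
Qed.

Lemma density_cdf0 t : t <= 0 -> phi t = 0.
Proof. by move=> t0; rewrite /phi density_mass_null// lebesgue01_rayN. Qed.

Lemma density_cdf1 t : 1 <= t -> phi t = 1.
Proof.
move=> t1; have -> : 1 = fine (nu [set: T]) by rewrite /density_mass h1.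
have -> : [set: T] = [set` `]-oo, t[] `|` [set` `[t, +oo[].
  by rewrite -itv_bndbnd_setU// set_itvNyy.
rewrite density_massU//; last first.
  rewrite -subset0 => x [] /=; rewrite !in_itv /= andbT => xt tx.
  by move: (lt_le_trans xt tx); rewrite ltxx.
rewrite fineD ?density_mass_fin// [X in _ + fine X]density_mass_null ?addr0//.
apply/eqP; rewrite -measure_le0 -lebesgue01_tail.
apply: le_measure; rewrite ?inE// => x /=; rewrite !in_itv /= !andbT.
exact: le_trans.
Qed.

(** Strict monotonicity, which makes density_cdf invertible on the unit
interval, comes from the density being positive everywhere. *)
Lemma density_cdf_strict s t : 0 <= s -> s < t -> s < 1 -> phi s < phi t.
Proof.
move=> s0 st s1.
have su : s < Num.min t 1 by rewrite lt_min st.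
apply: (@lt_le_trans _ _ (phi (Num.min t 1))); last first.
  by rewrite density_cdf_mono// ge_min lexx.
rewrite (density_cdfD (ltW su)) ltrDl fine_gt0//.
rewrite density_mass_gt0//=; last first.
  by rewrite lebesgue01_itvco ?(ltW su) ?ge_min ?lexx ?orbT// lte_fin subr_gt0.
by rewrite -ge0_fin_numE ?density_mass_ge0// density_mass_fin.
Qed.

Lemma density_cdf_continuous : continuous phi.
Proof.
have inth : mu.-integrable [set: T] (EFin \o h).
  apply/integrableP; split; first exact: mhE.
  rewrite (_ : (\int[mu]_x _)%E = 1%E) ?ltry// -h1.
  by apply: eq_integral => x _; rewrite /= ger0_norm// ltW.
move=> x; apply/cvgrPdist_lt => e e0.
have [dl [dl0 dlP]] := integral_normr_continuous inth e0.
have step s t : s <= t -> t - s < dl -> fine (nu [set` `[s, t[]) < e.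
  move=> st std; have mst : (mu [set` `[s, t[] < dl%:E)%E.
    by apply: le_lt_trans (lebesgue01_itvco_le st) _; rewrite lte_fin.
  apply: le_lt_trans (dlP _ (measurable_itv _) mst).
  rewrite /density_mass le_eqVlt; apply/orP; left; apply/eqP; congr fine.
  by apply: eq_integral => y _; rewrite ger0_norm// ltW.
exists dl => // t /=; rewrite ltr_norml => /andP[xt1 xt2].
have [xt|tx] := leP x t.
  rewrite (density_cdfD xt) opprD addrA subrr sub0r normrN.
  rewrite ger0_norm ?fine_ge0 ?density_mass_ge0// step//; lra.
rewrite (density_cdfD (ltW tx)) addrAC subrr add0r.
by rewrite ger0_norm ?fine_ge0 ?density_mass_ge0// step ?ltW.
Qed.

Lemma density_cdf_measurable : measurable_fun [set: T] (phi : T -> T).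
Proof. by apply: nondecreasing_measurable => //; exact: density_cdf_mono. Qed.

(** The preimage of a ray below level x is the ray below the point where
the distribution function equals x, whose mass is x. Rays generate the Borel
sets. *)
Lemma density_pushforward A : measurable A -> nu (phi @^-1` A) = mu A.
Proof.
have mphi (B : set T) : measurable B -> measurable ((phi : T -> T) @^-1` B).
  by move=> mB; rewrite -[X in measurable X]setTI; exact: density_cdf_measurable.
pose m (B : set T) := nu (phi @^-1` B).
have m0 : m set0 = 0%E by rewrite /m preimage_set0 /density_mass integral_set0.
have mge0 B : (0 <= m B)%E by exact: density_mass_ge0.
have madd : semi_sigma_additive m.
  move=> F mF tF mU; rewrite /m preimage_bigcup.
  apply: (semi_sigma_additive_nng_induced (mhE (A:=[set: T])) h_ge0).
  - by move=> i; exact: mphi.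
  - apply/trivIsetP => i j _ _ ij; rewrite -preimage_setI.
    by move/trivIsetP : tF => -> //; rewrite preimage_set0.
  - by rewrite -preimage_bigcup; exact: mphi.
pose M : {measure set T -> \bar R} := HB.pack m (isMeasure.Build _ _ _ m m0 mge0 madd).
have mG : @measurable _ T = <<s @RGenInftyO.G R >> by exact: RGenInftyO.measurableE.
have setIG : setI_closed (@RGenInftyO.G R).
  move=> _ _ [x ->] [y ->]; exists (Num.min x y); apply/seteqP; split => z /=.
    by rewrite !in_itv /= lt_min => -[-> ->].
  by rewrite !in_itv /= lt_min => /andP[].
have Gg n : @RGenInftyO.G R [set` `]-oo, n%:R[] by exists n%:R.
have cov : \bigcup_n [set` `]-oo, n%:R[] = [set: T].
  apply/seteqP; split=> // x _; exists (Num.truncn `|x|).+1 => //=.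
  by rewrite in_itv /= (le_lt_trans (ler_norm x))// truncnS_gt.
have Mfin n : (M [set` `]-oo, n%:R[] < +oo)%E.
  have mI : measurable ([set` `]-oo, n%:R[] : set T) by exact: measurable_itv.
  have := density_mass_fin (mphi _ mI).
  by rewrite ge0_fin_numE ?density_mass_ge0.
have MG B : @RGenInftyO.G R B -> M B = mu B.
  move=> [x ->]; rewrite /M /= /m.
  have phi_ge0 t : 0 <= phi t by rewrite fine_ge0// density_mass_ge0.
  have phi_le1 t : phi t <= 1.
    have [t1|t1] := leP t 1; last by rewrite density_cdf1// ltW.
    by rewrite -(density_cdf1 (lexx 1)) density_cdf_mono.
  have [x0|x0] := leP x 0.
    rewrite lebesgue01_rayN// (_ : _ @^-1` _ = set0).
      by rewrite /density_mass integral_set0.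
    rewrite -subset0 => t /=; rewrite in_itv /= => tx.
    by have := phi_ge0 t; lra.
  have [x1|x1] := leP x 1; last first.
    rewrite lebesgue01_ray1 ?ltW// (_ : _ @^-1` _ = [set: T])//.
    apply/seteqP; split=> // t _ /=; rewrite in_itv /=.
    exact: le_lt_trans (phi_le1 t) x1.
  have [c] : exists2 c, c \in `[0, 1] & phi c = x.
    apply: IVT => //.
      by apply: continuous_subspaceT; exact: density_cdf_continuous.
    rewrite density_cdf0// density_cdf1// min_l ?max_r ?ler01//.
    by rewrite (ltW x0).
  rewrite in_itv /= => /andP[c0 c1] cx.
  have {}c0 : 0 < c.
    rewrite lt_neqAle c0 andbT; apply/eqP => c0'.
    by move: x0; rewrite -cx -c0' density_cdf0// ltxx.
  rewrite (_ : _ @^-1` _ = [set` `]-oo, c[]); last first.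
    apply/seteqP; split => t /=; rewrite !in_itv /= -cx => tc.
      by rewrite ltNge; apply: contraTN tc => ct; rewrite -leNgt density_cdf_mono.
    have [t0|t0] := leP 0 t.
      by apply: density_cdf_strict => //; exact: lt_le_trans c1.
    by rewrite (density_cdf0 (ltW t0)) cx.
  rewrite lebesgue01_ray ?(ltW x0)// -cx /phi fineK//.
  exact: density_mass_fin.
exact: (measure_unique _ _ mG setIG Gg cov M mu MG Mfin).
Qed.

(** The left inverse of the distribution function, given by a formula that
makes it monotone, hence measurable, on the whole line. *)
Definition density_quantile (s : R) : R := sup [set t | 0 <= t <= 1 /\ phi t <= s].

Lemma density_cdfK t : 0 <= t <= 1 -> density_quantile (phi t) = t.
Proof.
move=> t01; have /andP[t0 t1] := t01; apply/eqP; rewrite eq_le; apply/andP; split.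
  apply: ge_sup; first by exists t.
  move=> u [/andP[u0 u1] ut]; rewrite leNgt; apply/negP => tu.
  by move: ut; rewrite leNgt density_cdf_strict// (lt_le_trans tu).
by apply: ub_le_sup; [exists 1 => u [/andP[]]|].
Qed.

Lemma density_quantile_measurable : measurable_fun [set: T] (density_quantile : T -> T).
Proof.
apply: nondecreasing_measurable => // s s' ss.
have ub z : has_ubound [set t | 0 <= t <= 1 /\ phi t <= z].
  by exists 1 => u [/andP[]].
have [E|/set0P[t0 Et0]] := eqVneq [set t | 0 <= t <= 1 /\ phi t <= s] set0.
  rewrite {1}/density_quantile E sup0 /density_quantile.
  have [->|/set0P[u [u01 us]]] := eqVneq [set t | 0 <= t <= 1 /\ phi t <= s'] set0.
    by rewrite sup0.
  have /andP[u0 _] := u01; apply: le_trans u0 _; apply: ub_le_sup => //.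
apply: ge_sup; first by exists t0.
move=> u [u01 us]; apply: ub_le_sup => //; split=> //; exact: le_trans ss.
Qed.

Import HBNNSimple.

Lemma density_integral_indic (B : set T) (r : R) : measurable B -> 0 <= r ->
  (\int[mu]_x ((h x)%:E * (r * \1_B (phi x))%:E) = r%:E * mu B)%E.
Proof.
move=> mB r0; have mpB : measurable ((phi : T -> T) @^-1` B).
  by rewrite -[X in measurable X]setTI; exact: density_cdf_measurable.
rewrite (eq_integral (fun x : T =>
  r%:E * ((h x)%:E * (\1_((phi : T -> T) @^-1` B) x)%:E))%E);
  last by move=> x _; rewrite -!EFinM mulrCA.
rewrite ge0_integralZl_EFin//; last 2 first.
- by move=> x _; rewrite mule_ge0.
- by apply: emeasurable_funM; [exact: mhE|exact/measurable_EFinP].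
congr (_ * _)%E; rewrite -(density_pushforward mB) /density_mass [RHS]integral_mkcond.
by rewrite epatch_indic.
Qed.

Lemma density_integral_nnsfun (g : {nnsfun T >-> R}) :
  (\int[mu]_x ((h x)%:E * (g (phi x))%:E) = \int[mu]_x (g x)%:E)%E.
Proof.
have mphi : measurable_fun [set: T] (phi : T -> T) := density_cdf_measurable.
under eq_integral => x _.
  rewrite fimfunE -fsumEFin// ge0_mule_fsumr; last first.
    by move=> r; rewrite EFinM nnfun_muleindic_ge0.
  over.
rewrite ge0_integral_fsum//; last 2 first.
- move=> r; apply: emeasurable_funM; first exact: mhE.
  apply/measurable_EFinP; apply: measurable_funM => //.
  by apply: (measurableT_comp _ mphi); exact: measurable_indic.
- by move=> r x _; rewrite mule_ge0// EFinM nnfun_muleindic_ge0.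
under [RHS]eq_integral do rewrite fimfunE -fsumEFin//.
rewrite [RHS]ge0_integral_fsum//; last 2 first.
- by move=> r; apply/measurable_EFinP; apply: measurable_funM.
- by move=> r x _; rewrite EFinM nnfun_muleindic_ge0.
apply: eq_fsbigr => r; rewrite inE => -[y _ <-].
rewrite density_integral_indic// integralZl_indic_nnsfun//.
by rewrite integral_indic// setIT.
Qed.

(** Change of variables, from indicators to nonnegative functions by monotone
convergence. *)
Lemma density_integral (g : T -> \bar R) : measurable_fun [set: T] g ->
  (forall x, (0 <= g x)%E) ->
  (\int[mu]_x ((h x)%:E * g (phi x)) = \int[mu]_x g x)%E.
Proof.
move=> mg g0.
have mphi : measurable_fun [set: T] (phi : T -> T) := density_cdf_measurable.
pose g_ := nnsfun_approx measurableT mg.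
have cvg_g x : (g_ n x)%:E @[n --> \oo] --> g x by exact: cvg_nnsfun_approx.
have mono_g x : {homo (fun n => g_ n x) : n m / (n <= m)%N >-> n <= m}.
  by move=> n m nm; exact/lefP/nd_nnsfun_approx.
transitivity (limn (fun n => (\int[mu]_x ((h x)%:E * (g_ n (phi x))%:E))%E)).
  rewrite -monotone_convergence//.
  - apply: eq_integral => x _; apply/esym/cvg_lim => //.
    by apply: cvgeZl => //; exact: cvg_g.
  - move=> n; apply: emeasurable_funM; first exact: mhE.
    by apply/measurable_EFinP; apply: (measurableT_comp _ mphi).
  - by move=> n x _; rewrite mule_ge0// lee_fin.
  - by move=> x _ n m nm; rewrite lee_wpmul2l// lee_fin mono_g.
under eq_fun do rewrite density_integral_nnsfun.
rewrite -monotone_convergence//.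
- by apply: eq_integral => x _; apply/cvg_lim => //; exact: cvg_g.
- by move=> n; exact/measurable_EFinP.
- by move=> n x _; rewrite lee_fin.
- by move=> x _ n m nm; rewrite lee_fin mono_g.
Qed.

End monotone_rearrangement.

(** * Weighted composition operators on L^p[0,1] *)

Section Kmeasurable_algebra.
Context (R : realType) (k : scalar_kind) d (Omega : measurableType d).
Local Notation K := (scalar_field R k).
Implicit Types f g : Omega -> K^o.

Lemma KmeasurableM f g : Kmeasurable f -> Kmeasurable g ->
  Kmeasurable (fun w => (f w : K) * g w : K^o).
Proof.
move=> [f1 f2] [g1 g2]; split.
- rewrite (_ : re \o _ = (fun w =>
    re (f w : K) * re (g w : K) - im (f w : K) * im (g w : K))).
    by apply: measurable_funB; apply: measurable_funM.
  by apply/funext => w /=; rewrite -reM.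
- rewrite (_ : im \o _ = (fun w =>
    re (f w : K) * im (g w : K) + im (f w : K) * re (g w : K))).
    by apply: measurable_funD; apply: measurable_funM.
  by apply/funext => w /=; rewrite -imM.
Qed.

(** Writing the inverse with a real power of the modulus exhibits it as a
measurable function; at 0 both sides vanish. *)
Lemma reV (z : K) : re z^-1 = re z * rnorm z `^ (- 2%:R).
Proof.
rewrite powRN powR_mulrn ?rnorm_ge0// rnorm_reim sqr_sqrtr ?addr_ge0 ?sqr_ge0//.
case: k z => [x|[a b]] /=; last by [].
rewrite expr0n addr0; have [->|x0] := eqVneq x 0; first by rewrite invr0 mul0r.
by field.
Qed.

Lemma imV (z : K) : im z^-1 = - im z * rnorm z `^ (- 2%:R).
Proof.
rewrite powRN powR_mulrn ?rnorm_ge0// rnorm_reim sqr_sqrtr ?addr_ge0 ?sqr_ge0//.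
case: k z => [x|[a b]] /=; first by rewrite oppr0 mul0r.
by rewrite mulNr.
Qed.

Lemma KmeasurableV f : Kmeasurable f -> Kmeasurable (fun w => (f w : K)^-1 : K^o).
Proof.
move=> mf; have mn : measurable_fun [set: Omega] (fun w => rnorm (f w) `^ (- 2%:R)).
  apply: (@measurableT_comp _ _ _ _ _ _ (@powR R ^~ (- 2%:R))) => //.
  exact: measurable_rnorm.
have [f1 f2] := mf; split.
- rewrite (_ : re \o _ = (fun w => re (f w : K) * rnorm (f w) `^ (- 2%:R))).
    exact: measurable_funM.
  by apply/funext => w /=; rewrite reV.
- rewrite (_ : im \o _ = (fun w => - im (f w : K) * rnorm (f w) `^ (- 2%:R))).
    by apply: measurable_funM => //; exact: measurableT_comp.
  by apply/funext => w /=; rewrite imV.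
Qed.

Lemma Kmeasurable_comp d' (T : measurableType d') (phi : T -> Omega) f :
  measurable_fun [set: T] phi -> Kmeasurable f ->
  Kmeasurable (fun w => f (phi w)).
Proof.
move=> mphi [f1 f2]; split; first exact: (measurableT_comp f1 mphi).
exact: (measurableT_comp f2 mphi).
Qed.

Lemma Kmeasurable_ofR (g : Omega -> R) : measurable_fun [set: Omega] g ->
  Kmeasurable (fun w => ofR k (g w) : K^o).
Proof.
move=> mg; split.
- by rewrite (_ : re \o _ = g)//; apply/funext => w /=; rewrite ofRK.
- rewrite (_ : im \o _ = cst 0); first exact: measurable_cst.
  by apply/funext => w /=; case: k.
Qed.

End Kmeasurable_algebra.

Section weighted_composition.
Context (R : realType) (k : scalar_kind) (p : R) (p1 : 1 <= p).
Local Notation K := (scalar_field R k).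
Local Notation T := (measurableTypeR R).
Local Notation mu := (lebesgue01 R).
Local Notation LpF := (LpFun k mu p1).
Local Notation L := (Lp01 k p1).
Local Open Scope quotient_scope.
Local Notation cl u := (\pi_(Lp k mu p1) u : L).

Lemma class_addE (u v : LpF) : cl u + cl v = cl (u + v).
Proof. by rewrite [RHS]Lp_addE. Qed.

Lemma class_scaleE (a : K) (u : LpF) : a *: cl u = cl (a *: u).
Proof. exact: (Lp_scaleE a u). Qed.

Lemma rnorm_class (u : LpF) : rnorm (cl u) = fine (Knorm mu p u).
Proof. by rewrite [LHS]rnorm_Lp KnormE. Qed.

Lemma class_ex (x : L) : exists u : LpF, x = cl u.
Proof. by exists (repr x); rewrite reprK. Qed.

Variable f : LpF.
Hypothesis f0 : forall w, f w != 0.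
Hypothesis f1 : (\int[mu]_w (rnorm (f w) `^ p)%:E = 1)%E.

Let h w := rnorm (f w) `^ p.

Let mh : measurable_fun [set: T] h.
Proof.
apply: (@measurableT_comp _ _ _ _ _ _ (@powR R ^~ p)) => //.
exact/measurable_rnorm/LpFun_meas.
Qed.

Let h_gt0 w : 0 < h w.
Proof. by rewrite powR_gt0// rnorm_gt0. Qed.

Let phi := density_cdf h.
Let psi := density_quantile h.
Let mphi : measurable_fun [set: T] (phi : T -> T) := density_cdf_measurable mh h_gt0 f1.
Let mpsi : measurable_fun [set: T] (psi : T -> T).
Proof. exact: density_quantile_measurable. Qed.

(** The weighted composition operator u -> f (u o phi), where phi is the
distribution function of |f|^p. It preserves the norm because phi sends the
measure with density |f|^p to the Lebesgue measure; the operator maps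
the constant function 1 to f. *)
Definition wcomp (u : T -> K^o) : T -> K^o := fun w => (f w : K) * u (phi w).

Lemma wcomp_measurable u : Kmeasurable u -> Kmeasurable (wcomp u).
Proof.
move=> mu_; apply: KmeasurableM; first exact: LpFun_meas.
exact: (Kmeasurable_comp mphi).
Qed.

Lemma wcomp_norm u : Kmeasurable u -> Knorm mu p (wcomp u) = Knorm mu p u.
Proof.
move=> mu_; rewrite !KnormE; congr (_ `^ _)%E.
have mg : measurable_fun [set: T] (fun w => (rnorm (u w) `^ p)%:E).
  apply/measurable_EFinP; apply: (@measurableT_comp _ _ _ _ _ _ (@powR R ^~ p)) => //.
  exact: measurable_rnorm.
rewrite -(density_integral mh h_gt0 f1 mg); last by move=> w; rewrite lee_fin powR_ge0.
by apply: eq_integral => w _; rewrite /wcomp rnormM powRM ?rnorm_ge0// EFinM.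
Qed.

Lemma wcomp_in (u : LpF) : wcomp u \in KLfun mu p1.
Proof.
rewrite inE; split; first exact/wcomp_measurable/LpFun_meas.
rewrite wcomp_norm; last exact: LpFun_meas.
by have := LpFun_fin u; rewrite ge0_fin_numE ?Knorm_ge0.
Qed.

Definition wcomp_Lp (u : LpF) : LpF := MkLpFun (wcomp_in u).

Lemma wcomp_LpB u v : wcomp_Lp u - wcomp_Lp v = wcomp_Lp (u - v).
Proof.
apply: val_inj; apply/funext => w.
exact: (esym (mulrBr (f w : K) (u (phi w)) (v (phi w)))).
Qed.

Lemma wcomp_class_eq u v : cl u = cl v -> cl (wcomp_Lp u) = cl (wcomp_Lp v).
Proof.
move=> /Lp_eqP uv; apply/Lp_eqP.
have : Knorm mu p (wcomp_Lp (u - v)) = 0%E.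
  rewrite wcomp_norm ?Knorm_ae0//; [exact: LpFun_meas| |exact: LpFun_meas].
  by apply: filterS uv => w e; rewrite LpFunB e subrr.
move=> /(Knorm0_ae p1 (LpFun_meas _)); rewrite -wcomp_LpB.
by apply: filterS => w /eqP; rewrite LpFunB subr_eq0 => /eqP.
Qed.

Definition wcomp_class (x : L) : L := cl (wcomp_Lp (repr (x : Lp k mu p1))).

Lemma wcomp_classE u : wcomp_class (cl u) = cl (wcomp_Lp u).
Proof. by apply: wcomp_class_eq; rewrite reprK. Qed.

Lemma wcomp_class_linear : linear wcomp_class.
Proof.
move=> a x y; have [u ->] := class_ex x; have [v ->] := class_ex y.
rewrite class_scaleE class_addE !wcomp_classE class_scaleE class_addE.
congr (\pi_(Lp k mu p1) _); apply: val_inj; apply/funext => w.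
change ((f w : K) * (a * u (phi w) + v (phi w)) =
  a * ((f w : K) * u (phi w)) + (f w : K) * v (phi w)).
by rewrite mulrDr mulrCA.
Qed.

Lemma wcomp_class_norm x : `|wcomp_class x| = `|x|.
Proof.
have [u ->] := class_ex x; rewrite wcomp_classE -!ofR_norm !rnorm_class.
by rewrite wcomp_norm//; exact: LpFun_meas.
Qed.

Lemma ae_unit_interval (P : T -> Prop) : (forall w, 0 <= w <= 1 -> P w) ->
  {ae mu, forall w, P w}.
Proof.
move=> HP; exists (~` [set` `[0 : R, 1]]); split.
- exact: measurableC.
- by rewrite lebesgue01E setICl measure0.
- by move=> w /= nP; rewrite in_itv /= => /HP.
Qed.

(** The preimage of u is (u / f) composed with the inverse of phi; the
equality holds on the unit interval, that is almost everywhere. *)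
Lemma wcomp_surj (u : LpF) : exists v : LpF, cl (wcomp_Lp v) = cl u.
Proof.
pose v : T -> K^o := fun w => (u (psi w) : K) * (f (psi w) : K)^-1.
have mv : Kmeasurable v.
  apply: KmeasurableM; first exact: (Kmeasurable_comp mpsi (LpFun_meas u)).
  exact: (Kmeasurable_comp mpsi (KmeasurableV (LpFun_meas f))).
have vu w : 0 <= w <= 1 -> wcomp v w = u w.
  move=> w01; rewrite /wcomp /v /psi /phi density_cdfK//.
  by rewrite mulrCA divff ?f0// mulr1.
have vin : v \in KLfun mu p1.
  rewrite inE; split=> //; rewrite -wcomp_norm//.
  have := LpFun_fin u; rewrite ge0_fin_numE ?Knorm_ge0//.
  rewrite (_ : Knorm mu p u = Knorm mu p (wcomp v))// !KnormE; congr (_ `^ _)%E.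
  have mpow (g : T -> K^o) : Kmeasurable g ->
      measurable_fun [set: T] (fun w => (rnorm (g w) `^ p)%:E).
    move=> mg; apply/measurable_EFinP.
    apply: (@measurableT_comp _ _ _ _ _ _ (@powR R ^~ p)) => //.
    exact: measurable_rnorm.
  apply: ae_eq_integral => //.
  - by apply: mpow; exact: LpFun_meas.
  - by apply: mpow; exact: wcomp_measurable.
  - by apply: ae_unit_interval => w /vu ->.
exists (MkLpFun vin); apply/Lp_eqP; apply: ae_unit_interval => w; exact: vu.
Qed.

Lemma wcomp_class_surj : set_surj [set: L] [set: L] wcomp_class.
Proof.
move=> y _; have [u ->] := class_ex y; have [v vu] := wcomp_surj u.
by exists (cl v) => //; rewrite wcomp_classE.
Qed.

Definition wcomp_iso : Iso L :=
  MkIso wcomp_class_linear wcomp_class_norm wcomp_class_surj.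

End weighted_composition.

Section almost_transitive.
Context (R : realType) (k : scalar_kind) (p : R) (p1 : 1 <= p).
Local Notation K := (scalar_field R k).
Local Notation T := (measurableTypeR R).
Local Notation mu := (lebesgue01 R).
Local Notation LpF := (LpFun k mu p1).
Local Notation L := (Lp01 k p1).
Local Open Scope quotient_scope.
Local Notation cl u := (\pi_(Lp k mu p1) u : L).

Lemma lebesgue01T : mu [set: T] = 1%E.
Proof.
by rewrite lebesgue01E setTI lebesgue_measure_itv /= lte_fin ltr01 -EFinB subr0.
Qed.

Lemma ofR_in (g : T -> R) (c : R) : measurable_fun [set: T] g ->
  (forall w, 0 <= g w <= c) ->
  (fun w => ofR k (g w) : K^o) \in KLfun mu p1 /\
  (Knorm mu p (fun w => ofR k (g w) : K^o) <= c%:E)%E.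
Proof.
move=> mg g01; have c0 : 0 <= c by have /andP[] := g01 0; exact: le_trans.
have p0 : 0 < p by exact: lt_le_trans p1.
have mK := Kmeasurable_ofR k mg.
suff gc : (Knorm mu p (fun w => ofR k (g w) : K^o) <= c%:E)%E.
  by split=> //; rewrite inE; split=> //; apply: le_lt_trans gc _; rewrite ltry.
rewrite KnormE.
have -> : c%:E = ((\int[mu]_w (cst (c `^ p)%:E w)) `^ p^-1)%E.
  rewrite integral_cst// lebesgue01T mule1 poweR_EFin -powRrM mulfV ?gt_eqF//.
  by rewrite powRr1.
apply: gt0_ler_poweR.
- by rewrite invr_ge0 ltW.
- rewrite in_itv/= leey andbT; apply: integral_ge0 => w _.
  by rewrite lee_fin powR_ge0.
- rewrite in_itv/= leey andbT; apply: integral_ge0 => w _.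
  by rewrite lee_fin powR_ge0.
apply: ge0_le_integral => //.
- by move=> w _; rewrite lee_fin powR_ge0.
- apply/measurable_EFinP; apply: (@measurableT_comp _ _ _ _ _ _ (@powR R ^~ p)) => //.
  exact: measurable_rnorm.
- move=> w _; rewrite lee_fin ge0_ler_powR ?nnegrE ?rnorm_ge0 ?(ltW p0)//.
  by have /andP[g0 gc] := g01 w; rewrite rnorm_ofR ger0_norm.
Qed.

(** Adding a small constant c on the set of zeros of u changes the norm by at
most c, and normalising the result costs another c. *)
Lemma nowhere_zero_dense (u : LpF) (e : R) : 0 < e -> rnorm (cl u) = 1 ->
  exists f : LpF, [/\ forall w, f w != 0,
    (\int[mu]_w (rnorm (f w) `^ p)%:E = 1)%E & rnorm (cl f - cl u) < e].
Proof.
move=> e0 u1; pose c := Num.min (e / 4) 2^-1.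
have c0 : 0 < c by rewrite lt_min divr_gt0//= invr_gt0.
have ce : c <= e / 4 by rewrite ge_min lexx.
have c2 : c <= 2^-1 by rewrite ge_min lexx orbT.
pose A := [set w : T | u w = 0].
have mA : measurable A.
  rewrite (_ : A = [set: T] `&` (fun w => rnorm (u w)) @^-1` [set 0]).
    by apply: measurable_rnorm => //; exact: LpFun_meas.
  rewrite setTI; apply/seteqP; split => w /=; last exact: rnorm_eq0.
  by move=> ->; rewrite rnorm0.
pose g w : R := c * \1_A w.
have mg : measurable_fun [set: T] g by apply: measurable_funM.
have gc w : 0 <= g w <= c.
  rewrite /g indicE; case: (w \in A); rewrite ?mulr1 ?mulr0 ?lexx ?(ltW c0)//.
have [gin gn] := ofR_in mg gc.
pose gL : LpF := MkLpFun gin.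
have rg : rnorm (cl gL) <= c.
  by rewrite rnorm_class -lee_fin fineK// LpFun_fin.
pose v : LpF := u + gL.
have v0 w : v w != 0.
  change ((u w : K) + ofR k (c * \1_A w) != 0 :> K).
  rewrite indicE; have [uw|uw] := pselect (u w = 0).
    rewrite mem_set// uw add0r mulr1 -rnorm_gt0 rnorm_ofR normr_gt0.
    by rewrite gt_eqF.
  by rewrite memNset// mulr0 ofR0 addr0; apply/eqP.
have clv : cl v = cl u + cl gL by rewrite class_addE.
pose r := rnorm (cl v).
have r1 : 1 - c <= r.
  rewrite /r clv; have := rnormB_ge (cl u) (- cl gL).
  by rewrite opprK rnormN u1; lra.
have r2 : r <= 1 + c by rewrite /r clv (le_trans (rnormD _ _))// u1 lerD2l.
have r0 : 0 < r by lra.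
pose f : LpF := ofR k r^-1 *: v.
have fv : cl f = ofR k r^-1 *: cl v by rewrite class_scaleE.
have nf : rnorm (cl f) = 1.
  by rewrite fv rnormZr gtr0_norm ?invr_gt0// mulVf ?gt_eqF.
exists f; split.
- move=> w; rewrite /f LpFunZ scaler_eq0 negb_or v0 andbT.
  by rewrite -rnorm_gt0 rnorm_ofR normr_gt0 invr_eq0 gt_eqF.
- have := nf; rewrite rnorm_class KnormE => nf1.
  have fin : ((\int[mu]_w (rnorm (f w) `^ p)%:E) `^ p^-1)%E \is a fin_num.
    by rewrite -KnormE LpFun_fin.
  move/(congr1 (@EFin R)): nf1; rewrite fineK// => /(congr1 (fun z => z `^ p)%E).
  have p0 : 0 < p by exact: lt_le_trans p1.
  rewrite -poweRrM mulVf ?gt_eqF// poweR1r poweRe1//.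
  by apply: integral_ge0 => w _; rewrite lee_fin powR_ge0.
- have -> : cl f - cl u = ofR k (r^-1 - 1) *: cl v + cl gL.
    rewrite fv ofRD ofRN ofR1 scalerBl scale1r -addrA; congr (_ + _).
    by rewrite clv opprD -addrA addNr addr0.
  rewrite (le_lt_trans (rnormD _ _))// rnormZr -/r -[r in _ * r]gtr0_norm// -normrM.
  rewrite mulrBl mulVf ?gt_eqF// mul1r.
  have : `|1 - r| <= c by rewrite ler_norml; lra.
  lra.
Qed.

End almost_transitive.

(** * Almost transitivity of L^p[0,1] *)

Section almost_transitivity.
Context (R : realType) (k : scalar_kind) (p : R) (p1 : 1 <= p).
Local Notation K := (scalar_field R k).
Local Notation T := (measurableTypeR R).
Local Notation mu := (lebesgue01 R).
Local Notation LpF := (LpFun k mu p1).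
Local Notation L := (Lp01 k p1).
Local Open Scope quotient_scope.
Local Notation cl u := (\pi_(Lp k mu p1) u : L).

Lemma constant_one_ex :
  exists2 one : LpF, (forall w, one w = 1) & rnorm (cl one) = 1.
Proof.
have [oin _] := @ofR_in R k p p1 (cst 1) 1 (measurable_cst _)
  (fun w => introT andP (conj ler01 (lexx 1))).
exists (MkLpFun oin) => [w|]; first exact: ofR1.
rewrite rnorm_class KnormE.
have -> : (\int[mu]_w (rnorm (MkLpFun oin w) `^ p)%:E = \int[mu]_w (cst 1 w))%E.
  apply: eq_integral => w _ /=; congr (_%:E).
  by rewrite rnorm_ofR normr1 powR1.
by rewrite integral_cst// mul1e lebesgue01T poweR1r.
Qed.

Lemma Lp01_neq0 : exists x : L, x != 0.
Proof.
have [one _ n1] := constant_one_ex; exists (cl one).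
by rewrite -rnorm_gt0 n1.
Qed.

Lemma Lp01_orbit_dense (x : L) (e : R) : 0 < e -> rnorm x = 1 ->
  forall one : LpF, (forall w, one w = 1) ->
  exists g : Iso L, rnorm (g (cl one) - x) < e.
Proof.
move=> e0; have [u ->] := class_ex x => u1 one onE.
have [f [f0 f1 fu]] := nowhere_zero_dense e0 u1.
exists (wcomp_iso f0 f1).
have -> // : wcomp_iso f0 f1 (cl one) = cl f.
rewrite [LHS]wcomp_classE; congr (\pi_(Lp k mu p1) _).
apply: val_inj; apply/funext => w.
change ((f w : K) * one (density_cdf (fun w => rnorm (f w) `^ p) w) = f w).
by rewrite onE mulr1.
Qed.

(** Both x and y are close to the orbit of the constant function 1. *)
Lemma Lp01_almost_transitive (x y : L) (e : R) : 0 < e ->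
  rnorm x = 1 -> rnorm y = 1 -> exists g : Iso L, rnorm (g y - x) < e.
Proof.
move=> e0 x1 y1; have [one oneE _] := constant_one_ex.
have e2 : 0 < e / 2 by rewrite divr_gt0.
have [g gx] := Lp01_orbit_dense e2 x1 oneE.
have [h hy] := Lp01_orbit_dense e2 y1 oneE.
exists (iso_mul g (iso_inv h)).
rewrite (le_lt_trans (rnormB_tri _ (g (cl one)) _))// [ltRHS](splitr e) ltrD//.
have -> : cl one = iso_inv h (h (cl one)) by rewrite [RHS]iso_funK.
by rewrite !rnorm_isoB rnormBC.
Qed.

(** A vector y that almost norms the operator, once normalised, can be moved
close to any unit vector x, and then x + g y is close to 2 x. *)
Lemma Lp01_Iso_index : G_numerical_index (@idfun (Iso L)) = 1.
Proof.
apply: numerical_index_eq1 => [|S cS S1]; first exact: Lp01_neq0.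
apply: numerical_radius_eq1 => //; first exact: Lp01_neq0.
(* The bound 1/2 on the tolerance keeps T y, hence y, away from zero. *)
move=> e e0; pose c := Num.min e 2^-1.
have c0 : 0 < c by rewrite lt_min e0 invr_gt0 ltr0n.
have ce : c <= e by rewrite ge_min lexx.
have c2 : c <= 2^-1 by rewrite ge_min lexx orbT.
have [y y1 Sy] : exists2 y : L, rnorm y <= 1 & 1 - c < rnorm (S y).
  by apply: opnorm_gt_ex; rewrite S1; lra.
have y0 : y != 0.
  apply/eqP => y0; move: Sy; rewrite y0 linear0 rnorm0; lra.
have ny : 0 < rnorm y by rewrite rnorm_gt0.
exists (ofR k (rnorm y)^-1 *: y); split.
- by rewrite rnorm_normalize.
- rewrite operatorZ rnormZr gtr0_norm ?invr_gt0// mulrC ltr_pdivlMr//.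
  apply: le_lt_trans Sy; apply: (@le_trans _ _ ((1 - c) * rnorm y)).
    by rewrite ler_wpM2r ?rnorm_ge0// lerD2l lerN2.
  by rewrite ler_piMr// subr_ge0 (le_trans c2)// invf_le1// ler1n.
- move=> x x1; have [g gx] := Lp01_almost_transitive e0 x1 (rnorm_normalize y0).
  exists g; move: gx; set z := ofR k _ *: y => gx.
  have := rnormB_ge (x + x) (x - g z).
  have -> : x + x = ofR k 2 *: x by rewrite (ofRD k 1 1) ofR1 scalerDl scale1r.
  have -> : ofR k 2 *: x - (x - g z) = x + g z.
    by rewrite (ofRD k 1 1) ofR1 scalerDl scale1r opprB addrA addrAC addrK.
  rewrite rnormZr x1 mulr1 ger0_norm// rnormBC.
  by apply: lt_le_trans; rewrite ltrD2l ltrN2.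
Qed.

End almost_transitivity.

Theorem theorem4p19 (R : realType) (k : scalar_kind) :
  (forall (X : completeNormedModType (scalar_field R k)) (G : groupType)
      (rho : {multiplicative G -> Iso X}),
    (exists x : X, x != 0) ->
    Radon_Nikodym_property X ->
    G_Daugavet rho ->
    G_numerical_index rho = 1)
  /\
  (forall (p : R) (p1 : 1 < p),
    G_numerical_index (@idfun (Iso (Lp01 k (ltW p1)))) = 1).
Proof.
split=> [X G rho X0 rnpX dX|p p1]; last exact: Lp01_Iso_index.
exact: Radon_Nikodym_Daugavet_index.
Qed.
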